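(* Let $\mathcal{A}$ be a commutative unital complex Banach algebra with unit $1_\mathcal{A}$, let $a=(a_n)_{n\in\mathbb{N}}\in \ell^1(\mathbb N,\mathcal A)$, and let $f_a(s)=\sum_{n\in \mathbb N} a_n n^{-s}$ for $s \in \mathcal H$. Then the following are equivalent: (i) $a$ is invertible in $\ell^1(\mathbb{N},\mathcal{A})$; (ii) $\overline{\{f_a(s):s\in\mathcal{H}\}}\subset G(\mathcal{A})$, where the closure is taken in $\mathcal A$; (iii) there is $(b_n)_{n\in\mathbb{N}} \in \ell^1(\mathbb N,\mathcal A)$ such that $(f_a(s))^{-1}=\sum_{n\in\mathbb{N}} b_n n^{-s}$ for all $s\in\mathcal{H}$. In particular, a function $f\in\mathcal{D}(\mathbb{N},\mathcal{A})$ is invertible in $\mathcal{D}(\mathbb{N},\mathcal{A})$ if and only if $\overline{\{f(s):s\in\mathcal H\}}\subset G(\mathcal{A})$.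
   Context: $\mathcal{H}=\{s\in\mathbb C:\operatorname{Re}s\geq 0\}$. $G(\mathcal A)$ denotes the set of invertible elements of $\mathcal A$. $\ell^1(\mathbb N,\mathcal A)$ is the set of sequences $(a_n)_{n\in\mathbb N}$ in $\mathcal A$ with $\|a\|_1=\sum_n\|a_n\|<\infty$, a unital Banach algebra under the Dirichlet convolution $(a\star b)_n=\sum_{k,l\in\mathbb N,\,kl=n}a_kb_l$ (unit: the sequence with $1_\mathcal A$ at $n=1$ and $0$ elsewhere). $\mathcal D(\mathbb N,\mathcal A)$ is the set of functions $f:\mathcal H\to\mathcal A$ of the form $f(s)=\sum_{n\in\mathbb N}f_n n^{-s}$ with $f_n\in\mathcal A$ and $\sum_n\|f_n\|<\infty$; it is a unital Banach algebra under pointwise multiplication and the norm $\sum_n\|f_n\|$, isometrically isomorphic to $\ell^1(\mathbb N,\mathcal A)$ via $(f_n)\mapsto f$. *)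

(* Defs.v *)
From HB Require Import structures.
From mathcomp Require Import all_boot all_order all_algebra.
From mathcomp Require Import all_classical all_reals all_analysis.
From mathcomp Require Import complex.
Set Implicit Arguments. Unset Strict Implicit. Unset Printing Implicit Defensive.
Import Order.TTheory GRing.Theory Num.Theory.
Import numFieldNormedType.Exports.
Local Open Scope ring_scope.
Local Open Scope classical_set_scope.

Record cbanach_alg (R : realType) (A : completeNormedModType R[i])
    (mul : A -> A -> A) (one : A) : Prop := CBanachAlg {
  ba_mulA : forall x y z, mul x (mul y z) = mul (mul x y) z ;
  ba_mulC : forall x y, mul x y = mul y x ;
  ba_mul1 : forall x, mul one x = x ;
  ba_mulDl : forall x y z, mul (x + y) z = mul x z + mul y z ;
  ba_mulZl : forall (k : R[i]) x y, mul (k *: x) y = k *: mul x y ;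
  ba_normM : forall x y, `|mul x y| <= `|x| * `|y| ;
  ba_norm1 : `|one| = 1
}.

Definition invertible (R : realType) (A : completeNormedModType R[i])
  (mul : A -> A -> A) (one : A) : set A :=
  [set x | exists y, mul x y = one].

(* Sequences indexed by N = {1,2,...} are encoded as [nat -> A] with value 0
   at index 0.  l1(N, A): a 0 = 0 and sum_n ||a_n|| < oo. *)
Definition l1 (R : realType) (A : completeNormedModType R[i]) (a : nat -> A) :=
  a 0%N = 0 /\ cvgn (series (fun n => `|a n|)).

Definition dconv (R : realType) (A : completeNormedModType R[i])
  (mul : A -> A -> A) (a b : nat -> A) : nat -> A :=
  fun n => if n == 0%N then 0
           else \sum_(d < n.+1 | (d %| n)%N) mul (a d) (b (n %/ d)%N).

Definition dunit (R : realType) (A : completeNormedModType R[i]) (one : A)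
  : nat -> A := fun n => if n == 1%N then one else 0.

Definition l1_invertible (R : realType) (A : completeNormedModType R[i])
  (mul : A -> A -> A) (one : A) (a : nat -> A) :=
  exists b, l1 b /\ dconv mul a b = dunit one /\ dconv mul b a = dunit one.

(* n^{-s} = exp(-s log n) for n >= 1, s complex (0 for the dummy n = 0) *)
Definition npow_neg (R : realType) (n : nat) (s : R[i]) : R[i] :=
  if n == 0%N then 0 else
  let e := expR (- complex.Re s * ln n%:R) in
  let t := complex.Im s * ln n%:R in
  ((e * cos t) +i* (- (e * sin t)))%C.

Definition Hplane (R : realType) : set R[i] := [set s | 0 <= complex.Re s].

Definition dirichlet (R : realType) (A : completeNormedModType R[i])
  (a : nat -> A) (s : R[i]) : A :=
  limn (series (fun n => npow_neg n s *: a n)).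

(* D(N, A) as functions on H (values outside H are irrelevant) *)
Definition inD (R : realType) (A : completeNormedModType R[i]) (f : R[i] -> A) :=
  exists a, l1 a /\ forall s, @Hplane R s -> f s = dirichlet a s.

Definition D_invertible (R : realType) (A : completeNormedModType R[i])
  (mul : A -> A -> A) (one : A) (f : R[i] -> A) :=
  exists g, inD g /\ forall s, @Hplane R s -> mul (f s) (g s) = one.

(* Main.v *)
(* Proof idea. For [s] in the half-plane the values [f_a(s)] form a relatively
   compact set, so (ii) yields a uniform bound [M] on the norms of the inverses.
   Approximate [a] in l1 by a truncation [P]; being a Dirichlet polynomial, [P]
   extends to [Re s >= -d], where its inverses are still bounded by [2M].
   Suppose that [q] is an l1 inverse of [P] on the line [Re s = x].  Then [q]
   lives on integers with boundedly many prime factors, and the coefficients of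
   [q ^ m] are at most [(2M) ^ m] by a mean value argument. Since
   [sum n ^ -d < oo] over those integers, the l1 norm of [q ^ m] on the line
   [Re s = x + d] is at most [B (2M) ^ m]: the spectral radius of [q] there is
   at most [2M], so every sequence at l1 distance less than [1 / (2M)] from [P]
   on that line is invertible. Such perturbations lead from the line
   [Re s = x] to [Re s = x - d]; starting at large [Re s], where [P] is close to
   the invertible constant [a_1], one descends to [Re s = -d], and a last
   perturbation goes from [P] to [a]. *)
Require Import Defs.
From HB Require Import structures.
From mathcomp Require Import all_boot all_order all_algebra.
From mathcomp Require Import all_classical all_reals all_analysis.
From mathcomp Require Import complex ring lra.
Set Implicit Arguments. Unset Strict Implicit. Unset Printing Implicit Defensive.
Import Order.TTheory GRing.Theory Num.Theory.
Import numFieldNormedType.Exports.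
Local Open Scope ring_scope.
Local Open Scope classical_set_scope.

(** * Real-valued norms *)

Section RealNorm.
Context {R : realType}.
Local Open Scope complex_scope.

(** Norms of [A] live in [R[i]], whose order is partial. Their real parts carry the same information
    and are open to [lra], [nra] and monotone limits. *)
Definition nrm (V : normedZmodType R[i]) (x : V) : R := complex.Re `|x|.

Section NormedZmodule.
Context {V : normedZmodType R[i]}.
Implicit Types x y : V.

Lemma nrmE x : `|x| = (nrm x)%:C.
Proof. by rewrite /nrm RRe_real// normr_real. Qed.

Lemma nrm_ge0 x : 0 <= nrm x.
Proof. by rewrite -ler0c -nrmE. Qed.

Lemma nrm0 : nrm (0 : V) = 0.
Proof. by rewrite /nrm normr0. Qed.

Lemma nrmN x : nrm (- x) = nrm x.
Proof. by rewrite /nrm normrN. Qed.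

Lemma nrmB x y : nrm (x - y) = nrm (y - x).
Proof. by rewrite /nrm distrC. Qed.

Lemma ler_nrmD x y : nrm (x + y) <= nrm x + nrm y.
Proof. by rewrite -lecR rmorphD/= -!nrmE ler_normD. Qed.

Lemma ler_nrmB x y : nrm (x - y) <= nrm x + nrm y.
Proof. by rewrite -[leRHS](congr1 (+%R _) (nrmN y)) ler_nrmD. Qed.

Lemma ler_nrm_sum I (r : seq I) (P : pred I) (F : I -> V) :
  nrm (\sum_(i <- r | P i) F i) <= \sum_(i <- r | P i) nrm (F i).
Proof.
elim/big_ind2 : _ => [|x a y b xa yb|//]; first by rewrite nrm0.
by rewrite (le_trans (ler_nrmD _ _))// lerD.
Qed.

Lemma nrm_eq0 x : (nrm x == 0) = (x == 0).
Proof. by rewrite -(normr_eq0 x) nrmE -(inj_eq (@complexI R)). Qed.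

End NormedZmodule.

Lemma nrm1 : nrm (1 : R[i]) = 1.
Proof. by rewrite /nrm normr1. Qed.

Lemma nrmcM (x y : R[i]) : nrm (x * y) = nrm x * nrm y.
Proof. by apply: (@complexI R); rewrite rmorphM/= -!nrmE normrM. Qed.

Lemma nrm_real (x : R) : nrm x%:C = `|x|.
Proof. by rewrite /nrm normc_def /= expr0n addr0 sqrtr_sqr. Qed.

Lemma nrmZ (V : normedModType R[i]) (k : R[i]) (x : V) :
  nrm (k *: x) = nrm k * nrm x.
Proof. by apply: (@complexI R); rewrite rmorphM/= -!nrmE normrZ. Qed.

Lemma cvg_nrm (V : normedModType R[i]) (T : Type) (F : set_system T)
    {FF : Filter F} (u : T -> V) (l : V) :
  (u @ F --> l) <-> (forall e : R, 0 < e -> \forall x \near F, nrm (l - u x) < e).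
Proof.
split=> [/cvgrPdist_lt ul e e0|ul].
  have := ul e%:C; rewrite ltcR => /(_ e0).
  by apply: filterS => x; rewrite nrmE ltcR.
apply/cvgrPdist_lt => e e0.
have eE : (complex.Re e)%:C = e by rewrite RRe_real// gtr0_real.
have := ul (complex.Re e); rewrite -ltcR eE => /(_ e0).
by apply: filterS => x; rewrite -ltcR -nrmE eE.
Qed.

Lemma cauchy_nrm (V : completeNormedModType R[i]) (F : set_system V)
    {FF : ProperFilter F} :
  (forall e : R, 0 < e -> exists x, \forall y \near F, nrm (x - y) < e) ->
  cvg F.
Proof.
move=> FC; apply/cauchy_cvgP/cauchy_exP => e e0.
have eE : (complex.Re e)%:C = e by rewrite RRe_real// gtr0_real.
have [] := FC (complex.Re e); first by rewrite -ltcR eE.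
move=> x Fx; exists x; apply: filterS Fx => y.
by rewrite -ltcR -nrmE eE -ball_normE.
Qed.

Lemma cvg_nrm_le (V : normedModType R[i]) (T : Type) (F : set_system T)
    {FF : ProperFilter F} (u : T -> V) (l : V) (C : R) :
  u @ F --> l -> (\forall x \near F, nrm (u x) <= C) -> nrm l <= C.
Proof.
move=> /cvg_nrm ul uC; apply/ler_addgt0Pr => e e0.
have [x [xe xC]] := filter_ex (filterI (ul e e0) uC).
have -> : l = u x + (l - u x) by rewrite addrC subrK.
by rewrite (le_trans (ler_nrmD _ _))// lerD// ltW.
Qed.

End RealNorm.

(** * Absolutely summable sequences and their evaluation *)

Section AbsolutelySummable.
Context {R : realType} {A : completeNormedModType R[i]}.
Local Open Scope complex_scope.
Implicit Types (a b : nat -> A) (C D : R).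

(** Bounding all partial sums replaces the value of the l1 norm: estimates become finite ones with
    explicit constants. *)
Definition nl1 a C := forall N, \sum_(0 <= n < N) nrm (a n) <= C.

Lemma nl1_ge0 a C : nl1 a C -> 0 <= C.
Proof. by move=> /(_ 0%N); rewrite big_nil. Qed.

Lemma nl1_le a C D : C <= D -> nl1 a C -> nl1 a D.
Proof. by move=> CD aC N; apply: le_trans CD. Qed.

Lemma sum_nrm_le a N M : (N <= M)%N ->
  \sum_(0 <= n < N) nrm (a n) <= \sum_(0 <= n < M) nrm (a n).
Proof.
move=> NM; rewrite (big_cat_nat (leq0n N) NM)/= lerDl.
by apply: sumr_ge0 => i _; exact: nrm_ge0.
Qed.

Lemma nl1_nrm a C n : nl1 a C -> nrm (a n) <= C.
Proof.
move=> /(_ n.+1); apply: le_trans; rewrite big_nat_recr//= lerDr.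
by apply: sumr_ge0 => i _; exact: nrm_ge0.
Qed.

Lemma nl1D a b C D : nl1 a C -> nl1 b D -> nl1 (fun n => a n + b n) (C + D).
Proof.
move=> aC bD N; apply: le_trans (lerD (aC N) (bD N)).
by rewrite -big_split/=; apply: ler_sum => i _; exact: ler_nrmD.
Qed.

Lemma nl1N a C : nl1 a C -> nl1 (fun n => - a n) C.
Proof. by move=> aC N; under eq_bigr do rewrite nrmN; exact: aC. Qed.

Lemma nl1_dom a (b : nat -> A) C : (forall n, nrm (b n) <= nrm (a n)) ->
  nl1 a C -> nl1 b C.
Proof. by move=> ba aC N; apply: le_trans (aC N); exact: ler_sum. Qed.

Lemma nl1_cvg a C : nl1 a C ->
  cvgn (fun N => \sum_(0 <= n < N) nrm (a n)).
Proof.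
move=> aC; apply: nondecreasing_is_cvgn.
  by move=> N M; exact: sum_nrm_le.
by exists C => _ [N _ <-].
Qed.

(** The partial sums in [l1] are images of nondecreasing real ones, for which convergence and
    boundedness agree. *)
Lemma l1P a : l1 a <-> a 0%N = 0 /\ exists C, nl1 a C.
Proof.
have serE N : series (fun n => `|a n|) N = (\sum_(0 <= n < N) nrm (a n))%:C.
  by rewrite /series/= rmorph_sum/=; apply: eq_bigr => i _; rewrite nrmE.
split=> -[a0 H]; split=> //.
  have /cvg_nrm/(_ 1 ltr01) [N _ lN] := H.
  exists (nrm (limn (series (fun n => `|a n|))) + 1) => n.
  apply: le_trans (sum_nrm_le a (leq_maxl n N)) _.
  have := lN (maxn n N) (leq_maxr n N); rewrite /= serE nrmB => /ltW h.
  rewrite -(@ger0_norm _ (\sum_(0 <= _ < _) _)); last first.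
    by apply: sumr_ge0 => i _; exact: nrm_ge0.
  rewrite -nrm_real -lerBlDl; apply: le_trans h.
  by rewrite lerBlDr (le_trans _ (ler_nrmD _ _))// subrK.
have [C aC] := H.
have /cvg_ex[l /= /cvgrPdist_lt al] := nl1_cvg aC.
apply: (@cvgP (R[i] : numFieldType) _ (l%:C)).
apply/(@cvg_nrm _ (R[i] : numFieldType)) => e e0.
apply: filterS (al e e0) => n; rewrite serE.
by rewrite -rmorphB/= nrm_real.
Qed.

Lemma nl1_tail a C (e : R) : nl1 a C -> 0 < e ->
  exists N, forall m, \sum_(N <= n < m) nrm (a n) <= e.
Proof.
move=> aC e0.
have ac := nl1_cvg aC.
have /cvgrPdist_le/(_ e e0)[N _ lN] := ac.
exists N => m; case: (leqP m N) => [mN|/ltnW Nm]; first by rewrite big_geq// ltW.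
have := lN N (leqnn N); rewrite /= => h.
have : \sum_(0 <= n < m) nrm (a n) <= limn (fun N => \sum_(0 <= n < N) nrm (a n)).
  by apply: (nondecreasing_cvgn_le _ ac) => x y; exact: sum_nrm_le.
rewrite (big_cat_nat (leq0n N) Nm)/= => h2.
rewrite -(lerD2l (\sum_(0 <= n < N) nrm (a n))) (le_trans h2)//.
by rewrite -lerBlDl (le_trans (ler_norm _)).
Qed.

Definition trunc N a : nat -> A := fun n => if (n < N)%N then a n else 0.

Lemma nl1_trunc N a C : nl1 a C -> nl1 (trunc N a) C.
Proof.
by apply: nl1_dom => n; rewrite /trunc; case: ifP; rewrite // nrm0 nrm_ge0.
Qed.

Lemma nl1_trunc_small a C (e : R) : nl1 a C -> 0 < e ->
  exists N0, forall N, (N0 <= N)%N -> nl1 (fun n => a n - trunc N a n) e.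
Proof.
move=> aC e0; have [N0 aN] := nl1_tail aC e0; exists N0 => N NN M.
case: (leqP M N) => [MN|/ltnW NM].
  rewrite big_nat big1 ?ltW// => i /andP[_ iM].
  by rewrite /trunc (leq_trans iM)// subrr nrm0.
rewrite (big_cat_nat (leq0n N) NM)/= big_nat big1 ?add0r; last first.
  by move=> i /andP[_ iM]; rewrite /trunc iM subrr nrm0.
apply: le_trans (aN M); rewrite (big_cat_nat NN NM)/=.
apply: ler_wpDl; first by apply: sumr_ge0 => i _; exact: nrm_ge0.
rewrite big_nat [leRHS]big_nat; apply: ler_sum => i /andP[Ni _].
by rewrite /trunc ltnNge Ni subr0.
Qed.

Section Evaluation.
Variable chi : nat -> R[i].

(** The weights stay abstract to cover both [npow_neg n s] and the constant [1]; the latter is used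
    in [perturbation] to sum a series of sequences coefficientwise. *)
Definition ev a : A := limn (series (fun n => chi n *: a n)).

Hypothesis chi1 : forall n, nrm (chi n) <= 1.

Lemma nrm_chiZ n (x : A) : nrm (chi n *: x) <= nrm x.
Proof. by rewrite nrmZ ler_piMl// nrm_ge0. Qed.

Lemma nl1_chi a C : nl1 a C -> nl1 (fun n => chi n *: a n) C.
Proof. by apply: nl1_dom => n; exact: nrm_chiZ. Qed.

Lemma cvg_ev a C : nl1 a C -> series (fun n => chi n *: a n) @ \oo --> ev a.
Proof.
move=> aC; apply: cauchy_nrm => e e0.
have e20 : 0 < e / 2 by rewrite divr_gt0.
have [N aN] := nl1_tail (nl1_chi aC) e20.
exists (series (fun n => chi n *: a n) N); exists N => // m /= Nm.
rewrite nrmB sub_series_geq//.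
apply: (@le_lt_trans _ _ (e / 2)); last by rewrite ltr_pdivrMr// ltr_pMr// ltr1n.
apply: le_trans (aN m); exact: ler_nrm_sum.
Qed.

Lemma ev_unique a l : series (fun n => chi n *: a n) @ \oo --> l -> ev a = l.
Proof. by move=> al; exact: cvg_lim. Qed.

Lemma ev_le a C : nl1 a C -> nrm (ev a) <= C.
Proof.
move=> aC; apply: (cvg_nrm_le (cvg_ev aC)); apply: nearW => N.
by apply: le_trans (nl1_chi aC N); exact: ler_nrm_sum.
Qed.

Lemma evD a b C D : nl1 a C -> nl1 b D -> ev (fun n => a n + b n) = ev a + ev b.
Proof.
move=> aC bD; apply: ev_unique.
rewrite (_ : series _ = fun n => series (fun n => chi n *: a n) n +
  series (fun n => chi n *: b n) n); first exact: cvgD (cvg_ev aC) (cvg_ev bD).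
apply/funext => n.
by rewrite /series/= -big_split/=; apply: eq_bigr => i _; rewrite scalerDr.
Qed.

Lemma evB a b C D : nl1 a C -> nl1 b D -> ev (fun n => a n - b n) = ev a - ev b.
Proof.
move=> aC bD; have := evD (nl1D aC (nl1N bD)) bD.
by under eq_fun do rewrite subrK; move=> ->; rewrite addrK.
Qed.

Lemma ev_trunc N a : ev (trunc N a) = \sum_(0 <= n < N) chi n *: a n.
Proof.
apply: ev_unique; apply/cvg_nrm => e e0; exists N => // M /= NM.
suff -> : series (fun n => chi n *: trunc N a n) M = \sum_(0 <= n < N) chi n *: a n.
  by rewrite subrr nrm0.
rewrite /series/= (big_cat_nat (leq0n N) NM)/= [X in _ + X = _]big_nat.
rewrite [X in _ + X = _]big1 ?addr0; last first.
  by move=> i /andP[Ni _]; rewrite /trunc ltnNge Ni scaler0.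
by rewrite big_nat [RHS]big_nat; apply: eq_bigr => i /andP[_ iN]; rewrite /trunc iN.
Qed.

End Evaluation.

End AbsolutelySummable.

(** * Dirichlet convolution *)

Section DirichletConvolution.
Context {R : realType} {A : completeNormedModType R[i]}.
Context {mul : A -> A -> A} {one : A} (HA : cbanach_alg mul one).
Implicit Types (x y z : A) (a b c : nat -> A) (C D : R).

Local Notation dconv := (dconv mul).
Local Notation dunit := (dunit one).

Lemma bamulC x y : mul x y = mul y x. Proof. exact: (ba_mulC HA). Qed.
Lemma bamulA x y z : mul x (mul y z) = mul (mul x y) z.
Proof. exact: (ba_mulA HA). Qed.
Lemma bamul1 x : mul one x = x. Proof. exact: (ba_mul1 HA). Qed.
Lemma bamulx1 x : mul x one = x. Proof. by rewrite bamulC bamul1. Qed.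
Lemma bamulDl x y z : mul (x + y) z = mul x z + mul y z.
Proof. exact: (ba_mulDl HA). Qed.
Lemma bamulDr x y z : mul x (y + z) = mul x y + mul x z.
Proof. by rewrite !(bamulC x) bamulDl. Qed.
Lemma bamulZl (k : R[i]) x y : mul (k *: x) y = k *: mul x y.
Proof. exact: (ba_mulZl HA). Qed.
Lemma bamulZr (k : R[i]) x y : mul x (k *: y) = k *: mul x y.
Proof. by rewrite !(bamulC x) bamulZl. Qed.
Lemma bamul0 x : mul 0 x = 0.
Proof. by have := bamulZl 0 0 x; rewrite !scale0r. Qed.
Lemma bamulx0 x : mul x 0 = 0. Proof. by rewrite bamulC bamul0. Qed.
Lemma bamulN x y : mul (- x) y = - mul x y.
Proof. by rewrite -scaleN1r bamulZl scaleN1r. Qed.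
Lemma bamulxN x y : mul x (- y) = - mul x y.
Proof. by rewrite !(bamulC x) bamulN. Qed.

Lemma bamul_suml I (r : seq I) (P : pred I) (F : I -> A) x :
  mul (\sum_(i <- r | P i) F i) x = \sum_(i <- r | P i) mul (F i) x.
Proof. exact: (big_morph (mul^~ x) (fun y z => bamulDl y z x) (bamul0 x)). Qed.

Lemma bamul_sumr I (r : seq I) (P : pred I) (F : I -> A) x :
  mul x (\sum_(i <- r | P i) F i) = \sum_(i <- r | P i) mul x (F i).
Proof. by rewrite bamulC bamul_suml; under eq_bigr do rewrite bamulC. Qed.

Lemma ler_nrmM x y : nrm (mul x y) <= nrm x * nrm y.
Proof. by rewrite -lecR rmorphM/= -!nrmE; exact: (ba_normM HA). Qed.

Lemma nrm_one : nrm one = 1.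
Proof. by rewrite /nrm (ba_norm1 HA). Qed.

Lemma dconv0 a b : dconv a b 0%N = 0. Proof. by []. Qed.

(** This form is symmetric in the two factors and has no quotient. The box size [N] is free, so that
    sums over different [n] can share one box and be exchanged. *)
Lemma dconvE a b n N : (0 < n)%N -> (n < N)%N ->
  dconv a b n = \sum_(i < N) \sum_(j < N | (i * j == n)%N) mul (a i) (b j).
Proof.
move=> n0 nN; rewrite /Defs.dconv gtn_eqF//.
rewrite (big_ord_widen_cond N (fun d => d %| n)%N
  (fun d => mul (a d) (b (n %/ d)%N)))//.
rewrite big_mkcond/=; apply: eq_bigr => i _.
case: ifPn => [/andP[idn _]|].
  have jN : (n %/ i < N)%N by rewrite (leq_ltn_trans (leq_div _ _)).
  have i0 : (0 < i)%N by exact: dvdn_gt0 idn.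
  rewrite (big_pred1 (Ordinal jN))//= => j/=.
  by rewrite -val_eqE/= eqn_div// mulnC.
move=> h; rewrite big_pred0// => j; apply: contraNF h => /eqP ijn.
have : (0 < i * j)%N by rewrite ijn.
by rewrite -ijn muln_gt0 dvdn_mulr//= => /andP[_ j0]; rewrite ltnS leq_pmulr.
Qed.

Lemma dconvC a b : dconv a b = dconv b a.
Proof.
apply/funext => -[//|n]; rewrite !(@dconvE _ _ _ n.+2)//.
rewrite (exchange_big_dep xpredT)//=; apply: eq_bigr => i _.
by apply: eq_big => [j|j _]; rewrite ?(mulnC i)// bamulC.
Qed.

Lemma dconv3E a b c n : (0 < n)%N -> dconv (dconv a b) c n =
  \sum_(i < n.+1) \sum_(j < n.+1) \sum_(k < n.+1 | (i * j * k == n)%N)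
    mul (mul (a i) (b j)) (c k).
Proof.
move=> n0; rewrite (@dconvE _ _ _ n.+1)// (exchange_big_dep xpredT)//=.
under [RHS]eq_bigr do rewrite (exchange_big_dep xpredT)//=.
rewrite [RHS]exchange_big/=; apply: eq_bigr => k _.
transitivity (\sum_(m < n.+1 | (m * k == n)%N) \sum_(i < n.+1)
   \sum_(j < n.+1 | (i * j == m)%N) mul (mul (a i) (b j)) (c k)).
  apply: eq_bigr => m /eqP mkn.
  have m0 : (0 < m)%N.
    have : (0 < m * k)%N by rewrite mkn.
    by rewrite muln_gt0 => /andP[].
  rewrite (@dconvE _ _ _ n.+1)// bamul_suml.
  by apply: eq_bigr => i _; rewrite bamul_suml.
rewrite exchange_big/=; apply: eq_bigr => i _.
rewrite (exchange_big_dep xpredT)//= [RHS]big_mkcond/=; apply: eq_bigr => j _.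
case: ifPn => [/eqP ijk|ijk].
  have ijn : (i * j < n.+1)%N.
    have : (0 < i * j * k)%N by rewrite ijk.
    by rewrite muln_gt0 => /andP[_ k0]; rewrite ltnS -[leqRHS]ijk leq_pmulr.
  rewrite (big_pred1 (Ordinal ijn))// => m; rewrite inE -val_eqE/= [RHS]eq_sym.
  by apply: andb_idl => /eqP <-; rewrite ijk.
rewrite big_pred0// => m; apply: contraNF ijk => /andP[mk /eqP ->].
exact: mk.
Qed.

(** After [dconvC] on the left, both sides are triple sums as in [dconv3E] and differ by a
    permutation of the three indices. *)
Lemma dconvA a b c : dconv a (dconv b c) = dconv (dconv a b) c.
Proof.
apply/funext => -[//|n]; rewrite dconvC !dconv3E// [RHS]exchange_big/=.
under [RHS]eq_bigr do under eq_bigr do rewrite big_mkcond/=.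
under [LHS]eq_bigr do under eq_bigr do rewrite big_mkcond/=.
under [RHS]eq_bigr do rewrite exchange_big/=.
apply: eq_bigr => j _; apply: eq_bigr => k _; apply: eq_bigr => i _.
by rewrite mulnC mulnA bamulC bamulA.
Qed.

Lemma dconvACA a b c d :
  dconv (dconv a b) (dconv c d) = dconv (dconv a c) (dconv b d).
Proof. by rewrite -!dconvA (dconvA b) (dconvC b c) -dconvA. Qed.

Lemma dconv1 a : a 0%N = 0 -> dconv dunit a = a.
Proof.
move=> a0; apply/funext => -[//|n]; rewrite /Defs.dconv/=.
rewrite (bigD1 (Ordinal (isT : 1 < n.+2)%N))//= divn1 bamul1 big1 ?addr0// => i.
move=> /andP[_]; rewrite -val_eqE/= /Defs.dunit => /negbTE ->.
by rewrite bamul0.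
Qed.

Lemma dconvDl a b c n :
  dconv (fun n => a n + b n) c n = dconv a c n + dconv b c n.
Proof.
case: n => [|n]; first by rewrite !dconv0 addr0.
by rewrite /Defs.dconv/= -big_split/=; apply: eq_bigr => i _; rewrite bamulDl.
Qed.

Lemma dconvNl a c n : dconv (fun n => - a n) c n = - dconv a c n.
Proof.
case: n => [|n]; first by rewrite !dconv0 oppr0.
by rewrite /Defs.dconv/= -sumrN; apply: eq_bigr => i _; rewrite bamulN.
Qed.

Lemma dconvBl a b c n :
  dconv (fun n => a n - b n) c n = dconv a c n - dconv b c n.
Proof. by rewrite (dconvDl a (fun n => - b n)) dconvNl. Qed.

Lemma dconvDr a b c n :
  dconv a (fun n => b n + c n) n = dconv a b n + dconv a c n.
Proof. by rewrite !(dconvC a) dconvDl. Qed.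

Lemma dconvBr a b c n :
  dconv a (fun n => b n - c n) n = dconv a b n - dconv a c n.
Proof. by rewrite !(dconvC a) dconvBl. Qed.

(** A pair [(i, j)] contributes only to the index [i * j], so the full double sum of
    [nrm (a i) * nrm (b j)] dominates. *)
Lemma nl1_dconv a b C D : nl1 a C -> nl1 b D -> nl1 (dconv a b) (C * D).
Proof.
move=> aC bD N; apply: (@le_trans _ _
  (\sum_(0 <= i < N) \sum_(0 <= j < N) nrm (a i) * nrm (b j))); last first.
  under eq_bigr do rewrite -big_distrr/=.
  rewrite -big_distrl/=; apply: ler_pM => //; apply: sumr_ge0 => i _;
  exact: nrm_ge0.
rewrite !big_mkord.
apply: (@le_trans _ _ (\sum_(n < N) \sum_(i < N) \sum_(j < N | (i * j == n)%N)
   nrm (a i) * nrm (b j))).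
  apply: ler_sum => n _; have [->|n0] := posnP n.
    rewrite dconv0 nrm0; apply: sumr_ge0 => i _; apply: sumr_ge0 => j _.
    by rewrite mulr_ge0// nrm_ge0.
  rewrite (@dconvE _ _ _ N)//; apply: le_trans (ler_nrm_sum _ _ _) _.
  apply: ler_sum => i _; apply: le_trans (ler_nrm_sum _ _ _) _.
  by apply: ler_sum => j _; exact: ler_nrmM.
rewrite exchange_big/=; apply: ler_sum => i _; rewrite big_mkord.
rewrite (exchange_big_dep xpredT)//=; apply: ler_sum => j _.
case: (ltnP (i * j) N) => ijN.
  by rewrite (big_pred1 (Ordinal ijN))// => n; rewrite -val_eqE/= eq_sym.
rewrite big_pred0 ?mulr_ge0 ?nrm_ge0// => n.
by rewrite gtn_eqF// (leq_trans _ ijN).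
Qed.

End DirichletConvolution.

(** * Multiplicativity of the evaluation *)

Section CompletelyMultiplicative.
Context {R : realType} {A : completeNormedModType R[i]}.
Context {mul : A -> A -> A} {one : A} (HA : cbanach_alg mul one).
Variable chi : nat -> R[i].
Hypothesis chi1 : forall n, nrm (chi n) <= 1.
Hypothesis chi0 : chi 0%N = 0.
Hypothesis chiM : forall m n, chi (m * n)%N = chi m * chi n.
Implicit Types (a b : nat -> A) (C D : R).

Lemma sum_dconv a b N :
  \sum_(0 <= n < N) chi n *: dconv mul a b n =
  \sum_(i < N) \sum_(j < N | (i * j < N)%N) mul (chi i *: a i) (chi j *: b j).
Proof.
rewrite big_mkord.
transitivity (\sum_(n < N) \sum_(i < N) \sum_(j < N | (i * j == n)%N)
   mul (chi i *: a i) (chi j *: b j)).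
  (* At index 0 the convolution is 0 by convention; the pairs with a zero index vanish too because
     [chi 0 = 0]. *)
  apply: eq_bigr => n _; have [->|n0] := posnP n.
    rewrite chi0 scale0r big1// => i _; rewrite big1// => j; rewrite muln_eq0.
    by case/orP => /eqP ->; rewrite chi0 scale0r ?(bamul0 HA) ?(bamulx0 HA).
  rewrite (dconvE _ _ n0 (ltn_ord n)) scaler_sumr; apply: eq_bigr => i _.
  rewrite scaler_sumr; apply: eq_bigr => j /eqP <-.
  by rewrite chiM (bamulZl HA) (bamulZr HA) scalerA.
rewrite exchange_big/=; apply: eq_bigr => i _.
rewrite (exchange_big_dep xpredT)//= [RHS]big_mkcond/=; apply: eq_bigr => j _.
case: (ltnP (i * j) N) => ijN.
  by rewrite (big_pred1 (Ordinal ijN))// => n; rewrite inE -val_eqE/= eq_sym.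
by rewrite big_pred0// => n; rewrite gtn_eqF// (leq_trans _ ijN).
Qed.

(* If [K ^ 2 <= i * j] then [K <= i] or [K <= j]. *)
Lemma sum_hyperbola a b C D K N (e : R) : nl1 a C -> nl1 b D -> (K * K <= N)%N ->
  (forall m, \sum_(K <= n < m) nrm (a n) <= e) ->
  (forall m, \sum_(K <= n < m) nrm (b n) <= e) ->
  \sum_(i < N) \sum_(j < N | (N <= i * j)%N) nrm (a i) * nrm (b j)
    <= e * D + C * e.
Proof.
move=> aC bD KN ae be.
have e0 : 0 <= e by apply: le_trans (ae 0%N); rewrite big_geq.
have tailE (c : nat -> A) : (forall m, \sum_(K <= n < m) nrm (c n) <= e) ->
    \sum_(i < N) (K <= i)%N%:R * nrm (c i) <= e.
  move=> /(_ N); apply: le_trans; have [NK|KN'] := leqP N K.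
    rewrite big_geq// big1// => i _.
    by rewrite leqNgt (leq_trans (ltn_ord i) NK) mul0r.
  rewrite -(big_mkord xpredT (fun i => (K <= i)%N%:R * nrm (c i))).
  rewrite (big_cat_nat (leq0n K) (ltnW KN'))/= big_nat big1 ?add0r; last first.
    by move=> i /andP[_ iK]; rewrite leqNgt iK mul0r.
  rewrite big_nat [leRHS]big_nat; apply: ler_sum => i /andP[-> _].
  by rewrite mul1r.
have aN : \sum_(i < N) nrm (a i) <= C by have := aC N; rewrite big_mkord.
have bN : \sum_(i < N) nrm (b i) <= D by have := bD N; rewrite big_mkord.
have sum_ge0 (c : nat -> A) : 0 <= \sum_(i < N) nrm (c i).
  by apply: sumr_ge0 => i _; exact: nrm_ge0.
have sum_ge0' (c : nat -> A) : 0 <= \sum_(i < N) (K <= i)%N%:R * nrm (c i).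
  by apply: sumr_ge0 => i _; rewrite mulr_ge0// nrm_ge0.
apply: (@le_trans _ _ ((\sum_(i < N) (K <= i)%N%:R * nrm (a i)) *
    (\sum_(j < N) nrm (b j)) +
   (\sum_(i < N) nrm (a i)) * (\sum_(j < N) (K <= j)%N%:R * nrm (b j)))); last first.
  by rewrite lerD// ler_pM// tailE.
rewrite !big_distrl -big_split/=; apply: ler_sum => i _.
rewrite !big_distrr -big_split/= big_mkcond/=; apply: ler_sum => j _.
have h : 0 <= nrm (a i) * nrm (b j) by rewrite mulr_ge0// nrm_ge0.
rewrite -mulrA (mulrCA (nrm (a i))) -mulrDl.
case: ifPn => [Nij|_]; last by rewrite mulr_ge0// addr_ge0.
rewrite ler_peMl// -natrD ler1n addn_gt0 !lt0b.
case: (leqP K i) => //= iK; case: (leqP K j) => //= jK.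
have : (i * j < K * K)%N by exact: ltn_mul.
by rewrite ltnNge (leq_trans KN).
Qed.

(** The product of the partial sums exceeds the partial sum of the product by the terms with
    [i, j < N <= i * j], which [sum_hyperbola] makes small. *)
Lemma ev_dconv a b C D : nl1 a C -> nl1 b D ->
  ev chi (dconv mul a b) = mul (ev chi a) (ev chi b).
Proof.
move=> aC bD; apply: (ev_unique); apply/cvg_nrm => e e0.
have C0 := nl1_ge0 aC; have D0 := nl1_ge0 bD.
(* Four errors arise, two of size [e1 * D] and two of size [C * e1]; the [+ 1] keeps the denominator
   positive and the final inequality strict. *)
pose e1 := e / (2 * (C + D + 1)).
have CD0 : 0 < 2 * (C + D + 1) by rewrite mulr_gt0// ltr_wpDl// addr_ge0.
have e10 : 0 < e1 by rewrite divr_gt0.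
have /cvg_nrm/(_ _ e10)[N1 _ aN1] := cvg_ev chi1 aC.
have /cvg_nrm/(_ _ e10)[N2 _ bN2] := cvg_ev chi1 bD.
have aC' := nl1_chi chi1 aC; have bD' := nl1_chi chi1 bD.
have [K1 aK1] := nl1_tail aC' e10.
have [K2 bK2] := nl1_tail bD' e10.
pose K := maxn K1 K2.
have tailK (c : nat -> A) K' : (K' <= K)%N ->
    (forall m, \sum_(K' <= n < m) nrm (c n) <= e1) ->
    (forall m, \sum_(K <= n < m) nrm (c n) <= e1).
  move=> KK ce m; have [mK|/ltnW Km] := leqP m K; first by rewrite big_geq// ltW.
  apply: le_trans (ce m); rewrite (big_cat_nat KK Km)/= lerDr.
  by apply: sumr_ge0 => i _; exact: nrm_ge0.
exists (maxn (K * K) (maxn N1 N2)) => // N /=; rewrite !geq_max => /and3P[KN N1N N2N].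
have {aN1} := aN1 N N1N; have {bN2} := bN2 N N2N.
rewrite /series/= sum_dconv !big_mkord.
set SA := \sum_(i < N) chi i *: a i; set SB := \sum_(i < N) chi i *: b i.
move=> SBe SAe.
have SAC : nrm SA <= C.
  apply: le_trans (ler_nrm_sum _ _ _) _.
  by have := aC' N; rewrite big_mkord.
have evD := ev_le chi1 bD.
have h := sum_hyperbola aC' bD' KN (tailK _ _ (leq_maxl _ _) aK1)
  (tailK _ _ (leq_maxr _ _) bK2).
set S := \sum_(i < N) _.
have -> : S = mul SA SB - \sum_(i < N) \sum_(j < N | (N <= i * j)%N)
    mul (chi i *: a i) (chi j *: b j).
  apply/eqP; rewrite eq_sym subr_eq; apply/eqP; rewrite /S -big_split/=.
  rewrite /SA (bamul_suml HA); apply: eq_bigr => i _.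
  rewrite /SB (bamul_sumr HA) (bigID (fun j : 'I_N => i * j < N)%N)/=.
  by congr (_ + _); apply: eq_bigl => j; rewrite -leqNgt.
set T := \sum_(i < N) _.
have Te : nrm T <= e1 * D + C * e1.
  apply: le_trans h; apply: le_trans (ler_nrm_sum _ _ _) _.
  apply: ler_sum => i _; apply: le_trans (ler_nrm_sum _ _ _) _.
  by apply: ler_sum => j _; exact: (ler_nrmM HA).
have -> : mul (ev chi a) (ev chi b) - (mul SA SB - T) =
   mul (ev chi a - SA) (ev chi b) + mul SA (ev chi b - SB) + T.
  rewrite (bamulDl HA) (bamulDr HA) (bamulN HA) (bamulxN HA).
  by rewrite opprB !addrA subrK addrAC.
have h1 : nrm (mul (ev chi a - SA) (ev chi b)) <= e1 * D.
  apply: le_trans (ler_nrmM HA _ _) _.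
  by apply: ler_pM; rewrite ?nrm_ge0// ltW.
have h2 : nrm (mul SA (ev chi b - SB)) <= C * e1.
  apply: le_trans (ler_nrmM HA _ _) _.
  by apply: ler_pM; rewrite ?nrm_ge0// ltW.
have h3 := ler_nrmD (mul (ev chi a - SA) (ev chi b) + mul SA (ev chi b - SB)) T.
have h4 := ler_nrmD (mul (ev chi a - SA) (ev chi b)) (mul SA (ev chi b - SB)).
have -> : e = e1 * (2 * (C + D + 1)) by rewrite /e1 divfK// gt_eqF.
clear -h1 h2 h3 h4 Te e10; nra.
Qed.

Lemma ev_dunit : chi 1%N = 1 -> ev chi (dunit one) = one.
Proof.
move=> chi11; have -> : dunit one = trunc 2 (dunit one).
  by apply/funext => -[|[|n]].
by rewrite ev_trunc !big_nat_recr//= big_nil chi11 scaler0 !add0r scale1r.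
Qed.

End CompletelyMultiplicative.

(** * Dirichlet characters of the half-plane and twists *)

Section Powers.
Context {R : realType}.
Local Open Scope complex_scope.
Implicit Types (n m : nat) (t x y : R) (s : R[i]).

(** This is [n ^ -x] for positive [n]. At the dummy index [ln 0 = 0] gives [wt x 0 = 1], whereas
    [npow_neg 0 s = 0]. *)
Definition wt x n : R := expR (- x * ln n%:R).

(** This is [exp (- i t)], the conjugate of the usual convention, so that [n ^ (- i t)] is
    [cis (t * ln n)]. *)
Definition cis t : R[i] := cos t -i* sin t.

Lemma natr_pos n : (0 < n)%N -> (n%:R : R) \is Num.pos.
Proof. by move=> n0; rewrite posrE ltr0n. Qed.

Lemma lnnM m n : (0 < m)%N -> (0 < n)%N ->
  ln (m * n)%:R = ln m%:R + ln n%:R :> R.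
Proof. by move=> m0 n0; rewrite natrM lnM// natr_pos. Qed.

Lemma wt_gt0 x n : 0 < wt x n. Proof. exact: expR_gt0. Qed.

Lemma wt1 x : wt x 1 = 1. Proof. by rewrite /wt ln1 mulr0 expR0. Qed.

Lemma wt0 n : wt 0 n = 1. Proof. by rewrite /wt oppr0 mul0r expR0. Qed.

Lemma wtM x m n : (0 < m)%N -> (0 < n)%N -> wt x (m * n) = wt x m * wt x n.
Proof. by move=> m0 n0; rewrite /wt lnnM// mulrDr expRD. Qed.

Lemma wtD x y n : wt (x + y) n = wt x n * wt y n.
Proof. by rewrite /wt opprD mulrDl expRD. Qed.

Lemma lnn_ge0 n : 0 <= ln n%:R :> R.
Proof. by case: n => [|n]; [rewrite ln0|rewrite ln_ge0// ler1n]. Qed.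

Lemma wt_anti x y n : x <= y -> wt y n <= wt x n.
Proof. by move=> xy; rewrite ler_expR ler_wpM2r ?lnn_ge0// lerN2. Qed.

Lemma wt_le1 x n : 0 <= x -> wt x n <= 1.
Proof. by move=> x0; rewrite -(wt0 n) wt_anti. Qed.

Lemma wt_lt1 x n : 0 < x -> (1 < n)%N -> wt x n < 1.
Proof. by move=> x0 n1; rewrite expR_lt1 mulNr oppr_lt0 mulr_gt0// ln_gt0// ltr1n. Qed.

Lemma cisD x y : cis (x + y) = cis x * cis y.
Proof.
by rewrite /cis cosD sinD; apply/eqP; rewrite eq_complex/=; apply/andP; split;
   apply/eqP; ring.
Qed.

Lemma cis0 : cis 0 = 1.
Proof. by rewrite /cis cos0 sin0 oppr0. Qed.

Lemma cisX x k : cis (k%:R * x) = cis x ^+ k.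
Proof.
elim: k => [|k IH]; first by rewrite mul0r cis0.
by rewrite -addn1 natrD mulrDl mul1r cisD IH exprD.
Qed.

Lemma nrm_cis x : nrm (cis x) = 1.
Proof. by rewrite /nrm normc_def /= sqrrN cos2Dsin2 sqrtr1. Qed.

Lemma cis_neq1 x : 0 < `|x| -> `|x| < 1 -> cis x != 1.
Proof.
move=> x0 x1; apply/eqP => /(congr1 (@complex.Im R))/= /eqP.
rewrite oppr_eq0; have pi1 : (1 : R) < pi.
  by apply: lt_le_trans (pi_ge2 R); rewrite ltr1n.
case: (leP 0 x) => hx; move: x0 x1; rewrite ?(ger0_norm hx) ?(ltr0_norm hx) => x0 x1.
  by rewrite gt_eqF// sin_gt0_pi// x0 (lt_trans x1).
by rewrite -oppr_eq0 -sinN gt_eqF// sin_gt0_pi// x0 (lt_trans x1).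
Qed.

Lemma npow_negE n x t : (0 < n)%N ->
  npow_neg n (x +i* t) = (wt x n)%:C * cis (t * ln n%:R).
Proof.
move=> n0; rewrite /npow_neg gtn_eqF//= /cis /wt.
by apply/eqP; rewrite eq_complex/=; apply/andP; split; apply/eqP; ring.
Qed.

Lemma npow_neg0 s : npow_neg 0 s = 0. Proof. by []. Qed.

Lemma npow_neg1 s : npow_neg 1 s = 1.
Proof.
by case: s => x t; rewrite npow_negE// ln1 mulr0 wt1 cis0 mulr1.
Qed.

Lemma npow_negM m n s : npow_neg (m * n) s = npow_neg m s * npow_neg n s.
Proof.
case: m => [|m]; first by rewrite mul0n mul0r.
case: n => [|n]; first by rewrite muln0 mulr0.
case: s => x t; rewrite !npow_negE// wtM// lnnM// mulrDr cisD rmorphM/=.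
by rewrite mulrACA.
Qed.

Lemma nrm_npow_neg n s : (0 < n)%N -> nrm (npow_neg n s) = wt (complex.Re s) n.
Proof.
case: s => x t n0; rewrite npow_negE// nrmcM nrm_cis mulr1 nrm_real.
by rewrite ger0_norm// ltW// wt_gt0.
Qed.

Lemma npow_neg_le1 s : Hplane s -> forall n, nrm (npow_neg n s) <= 1.
Proof.
move=> s0 [|n]; first by rewrite npow_neg0 nrm0.
by rewrite nrm_npow_neg// wt_le1.
Qed.

Lemma npow_neg_shift n x s : (0 < n)%N ->
  npow_neg n (x%:C + s) = npow_neg n s * (wt x n)%:C.
Proof.
case: s => y t n0; rewrite (_ : x%:C + _ = (x + y) +i* t)%C; last first.
  by apply/eqP; rewrite eq_complex/= add0r !eqxx.
by rewrite !npow_negE// wtD rmorphM/=; ring.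
Qed.

End Powers.

Section Twist.
Context {R : realType} {A : completeNormedModType R[i]}.
Context {mul : A -> A -> A} {one : A} (HA : cbanach_alg mul one).
Local Open Scope complex_scope.
Implicit Types (a b : nat -> A) (C D x y : R).

(** Twisting translates the function by [x] (see [dirichlet_shift]), so work on the line [Re s = x]
    becomes work on the imaginary axis. A negative [x] is harmless for truncated sequences. *)
Definition twist x a : nat -> A := fun n => (wt x n)%:C *: a n.

Lemma nrm_twist x a n : nrm (twist x a n) = wt x n * nrm (a n).
Proof. by rewrite nrmZ nrm_real ger0_norm// ltW// wt_gt0. Qed.

Lemma twist_eq0 x a n : a n = 0 -> twist x a n = 0.
Proof. by rewrite /twist => ->; rewrite scaler0. Qed.

Lemma twistD x y a : twist x (twist y a) = twist (x + y) a.
Proof. by apply/funext => n; rewrite /twist scalerA wtD rmorphM. Qed.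

Lemma twist0 a : twist 0 a = a.
Proof. by apply/funext => n; rewrite /twist wt0 scale1r. Qed.

Lemma twistB x a b : twist x (fun n => a n - b n) =
  fun n => twist x a n - twist x b n.
Proof. by apply/funext => n; rewrite /twist scalerBr. Qed.

Lemma twist_dunit x : twist x (dunit one) = dunit one.
Proof.
apply/funext => n; rewrite /twist /dunit; case: eqP => [->|_].
  by rewrite wt1 scale1r.
by rewrite scaler0.
Qed.

Lemma twist_dconv x a b :
  twist x (dconv mul a b) = dconv mul (twist x a) (twist x b).
Proof.
apply/funext => -[|n]; first by rewrite /twist scaler0.
rewrite /dconv/= /twist scaler_sumr; apply: eq_bigr => d dn.
rewrite (bamulZl HA) (bamulZr HA) scalerA -rmorphM/=.
have d0 : (0 < d)%N by exact: dvdn_gt0 dn.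
rewrite -wtM//; first by rewrite muln_divA// mulKn.
by rewrite divn_gt0// dvdn_leq.
Qed.

Lemma nl1_twist x a C : 0 <= x -> nl1 a C -> nl1 (twist x a) C.
Proof.
move=> x0; apply: nl1_dom => n; rewrite nrm_twist ler_piMl ?nrm_ge0//.
exact: wt_le1.
Qed.

Lemma dirichletE a s : dirichlet a s = ev (fun n => npow_neg n s) a.
Proof. by []. Qed.

Lemma dirichlet_shift x a s : dirichlet a (x%:C + s) = dirichlet (twist x a) s.
Proof.
rewrite !dirichletE /ev; congr (limn (series _)); apply/funext => -[|n].
  by rewrite !npow_neg0 !scale0r.
by rewrite npow_neg_shift// /twist scalerA.
Qed.

End Twist.

(** * Mean values and smooth integers *)

Section MeanValue.
Context {R : realType} {A : completeNormedModType R[i]}.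
Local Open Scope complex_scope.
Implicit Types (a g : nat -> A) (C M : R).

(** The geometric sum telescopes, hence stays bounded in [K] as soon as [z] differs from 1. *)
Lemma nrm_geometric (z : R[i]) K : nrm z = 1 ->
  nrm (1 - z) * nrm (\sum_(k < K) z ^+ k) <= 2.
Proof.
move=> z1; rewrite -nrmcM -opprB mulNr -subrX1 opprB.
apply: le_trans (ler_nrmB _ _) _; rewrite nrm1.
have -> : nrm (z ^+ K) = 1; last by [].
by elim: K => [|K IH]; rewrite ?expr0 ?nrm1// exprS nrmcM z1 IH mul1r.
Qed.

(* Averaging over [k < K] kills every frequency [z i != 1] as [K] grows. *)
Lemma frequency_le N (z : 'I_N -> R[i]) (g : 'I_N -> A) (i0 : 'I_N) M :
  (forall i, nrm (z i) = 1) -> z i0 = 1 -> (forall i, i != i0 -> z i != 1) ->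
  (forall k, nrm (\sum_i z i ^+ k *: g i) <= M) -> nrm (g i0) <= M.
Proof.
move=> z1 zi0 zi gM; rewrite leNgt; apply/negP; rewrite -subr_gt0 => d0.
set d := nrm (g i0) - M in d0.
pose D := \sum_(i | i != i0) 2 / nrm (1 - z i) * nrm (g i).
(* Summed over [k < K], the term at [i0] grows like [K] while all others together stay below [D]; a
   positive gap [d] contradicts the Archimedean property. *)
suff KD K : K%:R * d <= D.
  have := archi_boundP (x := D / d).
  have D0 : 0 <= D.
    by apply: sumr_ge0 => i _; rewrite mulr_ge0 ?divr_ge0 ?nrm_ge0.
  move=> /(_ (divr_ge0 D0 (ltW d0))); rewrite ltr_pdivrMr//.
  by rewrite ltNge KD.
rewrite /d mulrBr lerBlDr.
have -> : K%:R * nrm (g i0) = nrm ((K%:R : R[i]) *: g i0).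
  by rewrite nrmZ -(rmorph_nat (real_complex R)) nrm_real ger0_norm.
have -> : (K%:R : R[i]) *: g i0 = \sum_(k < K) \sum_i z i ^+ k *: g i -
    \sum_(i | i != i0) (\sum_(k < K) z i ^+ k) *: g i.
  rewrite exchange_big/= (bigD1 i0)//=.
  under eq_bigr do rewrite zi0 expr1n scale1r.
  rewrite sumr_const card_ord scaler_nat.
  under [X in _ = _ + _ - X]eq_bigr do rewrite scaler_suml.
  by rewrite addrK.
apply: le_trans (ler_nrmB _ _) _; rewrite addrC; apply: lerD.
  apply: le_trans (ler_nrm_sum _ _ _) _; apply: ler_sum => i ii0.
  rewrite nrmZ ler_wpM2r ?nrm_ge0// ler_pdivlMr; first by rewrite mulrC nrm_geometric.
  by rewrite lt_neqAle nrm_ge0 eq_sym nrm_eq0 subr_eq0 eq_sym zi.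
apply: le_trans (ler_nrm_sum _ _ _) _.
apply: (@le_trans _ _ (\sum_(k < K) M)); first by apply: ler_sum.
by rewrite sumr_const card_ord mulr_natl.
Qed.

(** The coefficient [a n] is the mean of [n ^ (i t) * f_a (i t)] over [t]. The mean is taken over
    the discrete points [t = k * h], after truncating [a] at a cost of [e]. *)
Lemma coef_le_sup a C M n : a 0%N = 0 -> nl1 a C ->
  (forall t : R, nrm (dirichlet a (0 +i* t)) <= M) -> nrm (a n) <= M.
Proof.
move=> a0 aC aM; apply/ler_addgt0Pr => e e0.
case: n => [|n'].
  by rewrite a0 nrm0 addr_ge0 ?(ltW e0)// (le_trans (nrm_ge0 _) (aM 0)).
have [N0 /(_ (maxn N0 n'.+2) (leq_maxl _ _))] := nl1_trunc_small aC e0.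
set N := maxn _ _ => aN.
have nN : (n'.+1 < N)%N by rewrite leq_max leqnn orbT.
have N0' : (0 < N)%N by exact: leq_trans nN.
(* Since [ln i < N] for [i < N], this step keeps every [h * (ln i - ln n)] inside the interval from
   -1 to 1, where only the angle 0 gives the value 1. *)
pose h : R := N%:R^-1.
have h0 : 0 < h by rewrite invr_gt0 ltr0n.
pose l (i : nat) : R := ln i%:R.
have lN (i : nat) : (i < N)%N -> l i < N%:R.
  case: i => [|i] iN; first by rewrite /l ln0// ltr0n.
  by rewrite (lt_trans (ln_sublinear _))// ?ltr0n// ltr_nat.
(* Index 0 carries the coefficient 0, so its frequency may be any number of modulus 1 other than
   1. *)
pose z (i : 'I_N) : R[i] :=
  if i == 0%N :> nat then -1 else cis (h * (l i - l n'.+1)).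
have z1 i : nrm (z i) = 1.
  by rewrite /z; case: ifP => _; rewrite ?nrmN ?nrm1 ?nrm_cis.
pose n : 'I_N := Ordinal nN.
apply: (@frequency_le _ z (fun i => a i) n (M + e)) => //.
- by rewrite /z/= subrr mulr0 cis0.
- move=> i; rewrite -val_eqE/= => ni; rewrite /z; case: ifPn => i0.
    by rewrite eq_sym -subr_eq0 opprK -(natrD _ 1 1) pnatr_eq0.
  have i0' : (0 < i)%N by rewrite lt0n.
  have ln0 j : 0 <= l j by exact: lnn_ge0.
  apply: cis_neq1.
    rewrite normr_gt0 mulf_neq0 ?(gt_eqF h0)// subr_eq0; apply: contraNneq ni.
    by move/ln_inj; rewrite !natr_pos// => /(_ isT isT)/eqP; rewrite eqr_nat.
  rewrite normrM (gtr0_norm h0) /h mulrC ltr_pdivrMr ?ltr0n// mul1r.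
  have := lN i (ltn_ord i); have := lN n'.+1 nN; have := ln0 i; have := ln0 n'.+1.
  move: (l i) (l n'.+1) => x y y0 x0 yN xN.
  by rewrite ltr_norml; apply/andP; split; lra.
move=> k; pose s : R[i] := 0 +i* (k%:R * h).
have sH : Hplane s by rewrite /Hplane/=.
have -> : \sum_i z i ^+ k *: a i =
    cis (- (k%:R * h * l n'.+1)) *: dirichlet (trunc N a) s.
  rewrite dirichletE ev_trunc big_mkord scaler_sumr; apply: eq_bigr => i _.
  rewrite /z; case: eqP => [->|/eqP i0]; first by rewrite a0 !scaler0.
  have i0' : (0 < i)%N by rewrite lt0n.
  rewrite scalerA /s npow_negE// wt0 mul1r -cisD -cisX; congr (cis _ *: _).
  by rewrite /l; ring.
rewrite nrmZ nrm_cis mul1r.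
have -> : dirichlet (trunc N a) s =
    dirichlet a s - dirichlet (fun n => a n - trunc N a n) s.
  rewrite [in X in _ = _ - X]dirichletE.
  rewrite (evB (npow_neg_le1 sH) aC (nl1_trunc N aC)) !dirichletE.
  by rewrite opprB addrC subrK.
apply: le_trans (ler_nrmB _ _) _; apply: lerD; first exact: aM.
by rewrite dirichletE; exact: (ev_le (npow_neg_le1 sH) aN).
Qed.

End MeanValue.

Section Smooth.
Context {R : realType}.

Notation smooth N n := ([pred p | p <= N]%N.-nat n).

Lemma smooth1 n : smooth 1 n -> n = 1%N.
Proof.
case: n => [//|[//|n]] /andP[_ /allP h].
have := h (pdiv n.+2); rewrite mem_primes pdiv_prime// pdiv_dvd => /(_ isT).
by rewrite inE/= leqNgt prime_gt1// pdiv_prime.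
Qed.

Lemma smooth_dvd N n : smooth N.+1 n -> ~~ (N.+1 %| n)%N -> smooth N n.
Proof.
move=> /andP[n0 /allP h] Nn; rewrite /pnat n0; apply/allP => p pn.
have := h p pn; rewrite !inE/= leq_eqVlt => /orP[/eqP pE|//].
by move: pn Nn; rewrite pE mem_primes => /and3P[_ _ ->].
Qed.

(* Splitting off the multiples of [N.+2] gives
   [W N.+2 <= W N.+1 + w N.+2 * W N.+2]. *)
Lemma smooth_sum_bounded (w : nat -> R) N :
  (forall n, 0 <= w n) -> (forall n, (1 < n)%N -> w n < 1) ->
  (forall m n, (0 < m)%N -> (0 < n)%N -> w (m * n)%N = w m * w n) ->
  exists B, forall X, \sum_(0 <= n < X | smooth N.+1 n) w n <= B.
Proof.
move=> w0 w1 wM; elim: N => [|N [B WB]].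
  exists (w 1%N) => X; rewrite big_mkcond/=.
  apply: (@le_trans _ _ (\sum_(0 <= n < X) if n == 1%N then w 1%N else 0)).
    apply: ler_sum => n _; case: ifPn => [/smooth1 ->//|_].
    by case: ifP.
  rewrite -big_mkcond big_mkord/=; case: (ltnP 1 X) => X1.
    by rewrite (big_pred1 (Ordinal X1)).
  by rewrite big_pred0// => i; rewrite ltn_eqF// (leq_trans (ltn_ord i)).
(* The splitting makes sense for composite [p] too, so the induction runs through all integers. The
   bound below solves [W <= B + w p * W] for [W]. *)
pose p := N.+2; have p1 := w1 p isT.
exists (B / (1 - w p)) => X; rewrite ler_pdivlMr ?subr_gt0// mulrBr mulr1 lerBlDr.
set W := \sum_(_ <= _ < _ | _) _.
rewrite {1}/W (bigID (fun n => p %| n)%N)/= addrC; apply: lerD.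
  apply: le_trans (WB X); rewrite big_mkcond [leRHS]big_mkcond/=.
  apply: ler_sum => n _; case: ifPn => [/andP[sn pn]|_]; last by case: ifP.
  by rewrite (smooth_dvd sn pn).
apply: (@le_trans _ _ (\sum_(0 <= n < X | smooth p n && (p %| n)%N)
   \sum_(0 <= m < X | (p * m == n)%N) w m * w p)).
  rewrite big_nat_cond [leRHS]big_nat_cond.
  apply: ler_sum => n /andP[/andP[_ nX] /andP[/andP[n0 _] pn]].
  have mX : (n %/ p < X)%N by rewrite (leq_ltn_trans (leq_div _ _)).
  rewrite big_mkord (big_pred1 (Ordinal mX)); last first.
    by move=> m; rewrite inE -[RHS]val_eqE/= eqn_div// (mulnC p).
  have np0 : (0 < n %/ p)%N by rewrite divn_gt0// dvdn_leq.
  by rewrite -(wM _ _ np0 (ltn0Sn N.+1)) divnK.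
rewrite (exchange_big_dep (fun m => smooth p m))/=; last first.
  by move=> n m /andP[sn _] /eqP E; move: sn; rewrite -E pnatM => /andP[].
rewrite /W big_distrl/=; apply: ler_sum => m sm.
rewrite big_mkord; case: (ltnP (p * m) X) => pmX; last first.
  rewrite big_pred0 ?mulr_ge0// => n.
  by rewrite [(p * m == n)%N]gtn_eqF ?andbF// (leq_trans _ pmX).
rewrite big_mkcond (bigD1 (Ordinal pmX))//= eqxx andbT big1 ?addr0; last first.
  move=> n; rewrite -val_eqE/= eq_sym => /negbTE ->; rewrite andbF//.
by case: ifP => // _; rewrite mulr_ge0.
Qed.

End Smooth.

Section Restriction.
Context {R : realType} {A : completeNormedModType R[i]}.
Context {mul : A -> A -> A} {one : A} (HA : cbanach_alg mul one).
Implicit Types (a b : nat -> A) (pi : nat_pred).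

Definition restr pi a : nat -> A := fun n => if pi.-nat n then a n else 0.

(** A product lies in [pi.-nat] exactly when both factors do: for such [n] the convolution is
    unchanged, and for other [n] every term has a vanishing factor. This makes an inverse of a
    Dirichlet polynomial live on smooth integers. *)
Lemma dconv_restr pi a b : (forall n, ~~ pi.-nat n -> a n = 0) ->
  dconv mul a b = dunit one -> dconv mul a (restr pi b) = dunit one.
Proof.
move=> api ab; apply/funext => n; have [->|n0] := posnP n; first by [].
have [npi|npi] := boolP (pi.-nat n).
  rewrite -ab /dconv gtn_eqF//; apply: eq_bigr => d dn.
  by move: npi; rewrite /restr -{1}(divnK dn) pnatM => /andP[-> _].
have -> : dunit one n = 0.
  by rewrite /dunit; case: eqP npi => // ->.
rewrite /dconv gtn_eqF// big1// => d dn; rewrite /restr.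
have [dpi|/api ->] := boolP (pi.-nat d); last by rewrite (bamul0 HA).
by move: npi; rewrite -{1}(divnK dn) pnatM dpi andbT => /negbTE ->; rewrite (bamulx0 HA).
Qed.

End Restriction.

(** * Perturbation of invertible sequences *)

Section Perturbation.
Context {R : realType} {A : completeNormedModType R[i]}.
Context {mul : A -> A -> A} {one : A} (HA : cbanach_alg mul one).
Local Open Scope complex_scope.
Implicit Types (a b u v w : nat -> A) (B C D M : R).

Local Notation dconv := (dconv mul).
Local Notation dunit := (dunit one).

Lemma nl1_dunit : nl1 dunit 1.
Proof.
case=> [|[|N]]; first by rewrite big_nil.
  by rewrite big_nat1 nrm0.
rewrite big_nat_recl// big_nat_recl// big1 => [|i _]; last exact: nrm0.
by rewrite nrm0 add0r addr0 /Defs.dunit/= (nrm_one HA).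
Qed.

Lemma sum_cvg0 (u : nat -> nat -> A) w N :
  (forall n, u K n @[K --> \oo] --> w n) -> forall e : R, 0 < e ->
  \forall K \near \oo, \sum_(0 <= n < N) nrm (w n - u K n) <= e.
Proof.
move=> uw; elim: N => [|N IH] e e0; first by apply: nearW => K; rewrite big_nil ltW.
have e2 : 0 < e / 2 by rewrite divr_gt0.
have /cvg_nrm/(_ _ e2) := uw N; apply: filterS2 (IH _ e2) => K h1 h2.
by rewrite big_nat_recr//= (splitr e) lerD// ltW.
Qed.

Lemma nl1_limit (u : nat -> nat -> A) w B :
  (forall n, u K n @[K --> \oo] --> w n) -> (forall K, nl1 (u K) B) -> nl1 w B.
Proof.
move=> uw uB N; apply/ler_addgt0Pr => e e0.
have [K _ /(_ K (leqnn K)) h] := sum_cvg0 N uw e0; rewrite addrC.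
apply: le_trans (lerD h (uB K N)); rewrite -big_split/=.
by apply: ler_sum => n _; rewrite -{1}(subrK (u K n) (w n)) ler_nrmD.
Qed.

(** A coefficient of the product sees only finitely many coefficients of each factor, so pointwise
    convergence suffices for the passage to the limit in [perturbation]. *)
Lemma nrm_dconv_le a b n : nrm (dconv a b n) <=
  (\sum_(0 <= i < n.+1) nrm (a i)) * (\sum_(0 <= j < n.+1) nrm (b j)).
Proof.
case: n => [|n].
  by rewrite dconv0 nrm0 mulr_ge0// sumr_ge0// => i _; exact: nrm_ge0.
rewrite !big_mkord (@dconvE _ _ _ _ _ _ n.+2)// big_distrl/=.
apply: le_trans (ler_nrm_sum _ _ _) _; apply: ler_sum => i _.
rewrite big_distrr/=; apply: le_trans (ler_nrm_sum _ _ _) _.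
rewrite big_mkcond; apply: ler_sum => j _; case: ifP => _; first exact: (ler_nrmM HA).
by rewrite mulr_ge0// nrm_ge0.
Qed.

Definition dpow v m : nat -> A := iter m (dconv v) dunit.

Lemma dpow0 v m : dpow v m 0%N = 0. Proof. by case: m. Qed.

Lemma nl1_dpow v C m : nl1 v C -> nl1 (dpow v m) (C ^+ m).
Proof.
move=> vC; elim: m => [|m IH]; first by rewrite expr0; exact: nl1_dunit.
by rewrite exprS; exact: (nl1_dconv HA vC IH).
Qed.

Lemma twist_dpow x v m : twist x (dpow v m) = dpow (twist x v) m.
Proof.
by elim: m => [|m IH]/=; [exact: twist_dunit|rewrite (twist_dconv HA) IH].
Qed.

Lemma dpow_support (pi : nat_pred) v m : (forall n, ~~ pi.-nat n -> v n = 0) ->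
  forall n, ~~ pi.-nat n -> dpow v m n = 0.
Proof.
move=> vpi; elim: m => [|m IH] [|n]//= npi.
  by rewrite /Defs.dunit; case: eqP npi => // ->.
rewrite /Defs.dconv/= big1// => d dn.
have [dpi|/vpi ->] := boolP (pi.-nat d); last by rewrite (bamul0 HA).
rewrite IH ?(bamulx0 HA)//; apply: contra npi => npi.
by rewrite -(divnK dn) pnatM npi.
Qed.

Lemma dirichlet_dpow_le v C M s m : Hplane s -> nl1 v C ->
  nrm (dirichlet v s) <= M -> nrm (dirichlet (dpow v m) s) <= M ^+ m.
Proof.
move=> sH vC vM; have s1 := npow_neg_le1 sH.
have M0 : 0 <= M by apply: le_trans vM; exact: nrm_ge0.
elim: m => [|m IH]; rewrite !dirichletE/=.
  by rewrite ev_dunit ?(nrm_one HA)// npow_neg1.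
rewrite (ev_dconv HA s1 (npow_neg0 s) (fun i j => npow_negM i j s) vC (nl1_dpow m vC)).
apply: le_trans (ler_nrmM HA _ _) _; rewrite exprS.
by apply: ler_pM; rewrite ?nrm_ge0.
Qed.

(* The coefficients of [dpow v m] are at most [M ^+ m], and a positive twist
   makes the sum over smooth integers converge. *)
Lemma nl1_dpow_twist v C M N (d : R) : 0 < d -> nl1 v C ->
  (forall n, ~~ [pred p | p <= N.+1]%N.-nat n -> v n = 0) ->
  (forall t : R, nrm (dirichlet v (0 +i* t)) <= M) ->
  exists2 B, 0 <= B & forall m, nl1 (dpow (twist d v) m) (B * M ^+ m).
Proof.
move=> d0 vC vN vM.
have [] := @smooth_sum_bounded R (wt d) N.
- by move=> n; rewrite ltW// wt_gt0.
- by move=> n; exact: wt_lt1.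
- by move=> m n; exact: wtM.
move=> B wB; have B0 : 0 <= B by have := wB 0%N; rewrite big_nil.
exists B => // m K; rewrite -twist_dpow.
have M0 : 0 <= M by apply: le_trans (vM 0); exact: nrm_ge0.
apply: le_trans (ler_wpM2r (exprn_ge0 m M0) (wB K)); rewrite big_distrl/=.
rewrite [leRHS]big_mkcond; apply: ler_sum => n _; rewrite nrm_twist.
case: ifPn => [_|/(dpow_support m vN) ->]; last by rewrite nrm0 mulr0.
rewrite ler_wpM2l ?(ltW (wt_gt0 _ _))//.
apply: (coef_le_sup n (dpow0 v m) (nl1_dpow m vC)) => t.
by apply: dirichlet_dpow_le vC (vM t); rewrite /Hplane/=.
Qed.

(** The form of [l1_invertible] adapted to explicit bounds; [l1P] and [dconvC] translate back. *)
Definition dinvertible u :=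
  exists v, [/\ v 0%N = 0, exists C, nl1 v C & dconv u v = dunit].

(* The inverse of [u - b] is the sum of the [v ^ m.+1 * b ^ m]. *)
Lemma perturbation u v b B C M : v 0%N = 0 -> b 0%N = 0 ->
  dconv u v = dunit -> (forall m, nl1 (dpow v m) (B * M ^+ m)) -> nl1 b C ->
  0 <= M -> C * M < 1 -> dinvertible (fun n => u n - b n).
Proof.
move=> v0 b0 uv vM bC M0 CM1.
have C0 := nl1_ge0 bC.
have B0 : 0 <= B by have := nl1_ge0 (vM 0%N); rewrite mulr1.
pose x m := dconv (dpow v m.+1) (dpow b m).
have xC m : nl1 (x m) (B * M * (C * M) ^+ m).
  have := nl1_dconv HA (vM m.+1) (nl1_dpow m bC).
  by apply: nl1_le; rewrite exprS exprMn le_eqVlt; apply/orP; left; apply/eqP; ring.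
have x0 : dconv u (x 0%N) = dunit.
  rewrite /x/= (dconvC HA _ dunit) (dconv1 HA)//.
  by rewrite (dconvC HA v) (dconv1 HA).
(* With [x0], this makes the series of the [x m] telescope under multiplication by [u - b]. *)
have xS m : dconv u (x m.+1) = dconv b (x m).
  rewrite /x (_ : dpow v m.+2 = dconv v (dpow v m.+1))//.
  rewrite (_ : dpow b m.+1 = dconv b (dpow b m))// (dconvACA HA).
  by rewrite (dconvA HA u) (dconvA HA u v) uv (dconv1 HA b0).
pose G := B * M / (1 - C * M).
have CM0 : 0 <= C * M by rewrite mulr_ge0.
have geom K : \sum_(0 <= m < K) B * M * (C * M) ^+ m <= G.
  rewrite -big_distrr/= /G ler_wpM2l ?mulr_ge0//.
  rewrite -[leRHS]mul1r ler_pdivlMr ?subr_gt0// big_mkord mulrC.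
  rewrite -opprB mulNr -subrX1 opprB gerBl; exact: exprn_ge0.
pose W K n := \sum_(0 <= m < K) x m n.
have WG K : nl1 (W K) G.
  move=> N; apply: le_trans (geom K).
  apply: (@le_trans _ _ (\sum_(0 <= n < N) \sum_(0 <= m < K) nrm (x m n))).
    by apply: ler_sum => n _; exact: ler_nrm_sum.
  by rewrite exchange_big/=; apply: ler_sum => m _; exact: xC.
have xG n : nl1 (fun m => x m n) G.
  by move=> K; apply: le_trans (geom K); apply: ler_sum => m _; exact: nl1_nrm.
pose w n := ev (fun=> 1) (fun m => x m n).
have one1 : forall n : nat, nrm (1 : R[i]) <= 1 by move=> _; rewrite nrm1.
have Ww n : W K n @[K --> \oo] --> w n.
  rewrite (_ : (fun K => W K n) = series (fun m => 1 *: x m n)); first exact: cvg_ev.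
  by apply/funext => K; rewrite /series/=; under eq_bigr do rewrite scale1r.
have wG : nl1 w G by exact: nl1_limit Ww WG.
(* Taking one more term in the first product leaves no remainder, and [W K.+1] and [W K] have the
   same limit [w]. *)
have WE K n : dconv u (W K.+1) n - dconv b (W K) n = dunit n.
  elim: K => [|K IH].
    rewrite (_ : W 1%N = x 0%N); last by apply/funext => i; rewrite /W big_nat1.
    (* The zero sequence is written as a difference so that [dconvBr] annihilates its product with
       [b]. *)
    rewrite x0 (_ : W 0%N = fun i => 0 - 0).
      by rewrite (dconvBr HA) subrr subr0.
    by apply/funext => i; rewrite /W big_nil subrr.
  have WS J : W J.+1 = fun i => W J i + x J i.
    by apply/funext => i; rewrite /W big_nat_recr.
  rewrite (WS K.+1) (dconvDr HA) xS -IH (WS K) !(dconvDr HA).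
  by rewrite opprD addrACA subrr addr0.
have w0 : w 0%N = 0.
  apply/eqP; rewrite -nrm_eq0 eq_le nrm_ge0 andbT; apply: ev_le => // K.
  by rewrite big1// => m _; rewrite nrm0.
exists w; split => //; first by exists G.
apply/funext => n; rewrite (dconvBl HA); apply/eqP; rewrite -subr_eq0 -nrm_eq0.
rewrite eq_le nrm_ge0 andbT; apply/ler_addgt0Pr => e e0; rewrite add0r.
pose U := \sum_(0 <= i < n.+1) nrm (u i) + \sum_(0 <= i < n.+1) nrm (b i).
have U0 : 0 <= U by rewrite addr_ge0// sumr_ge0// => i _; exact: nrm_ge0.
have e1 : 0 < e / (U + 1) by rewrite divr_gt0// ltr_wpDl.
have [K _ wW] := sum_cvg0 n.+1 Ww e1.
have h1 := wW K (leqnn K); have h2 := wW K.+1 (leqnSn K).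
rewrite -(WE K n).
have -> : dconv u w n - dconv b w n - (dconv u (W K.+1) n - dconv b (W K) n) =
    dconv u (fun i => w i - W K.+1 i) n - dconv b (fun i => w i - W K i) n.
  by rewrite !(dconvBr HA) !opprB addrACA [RHS]addrACA [X in _ + X = _]addrC.
apply: le_trans (ler_nrmB _ _) _.
apply: le_trans (lerD (nrm_dconv_le _ _ _) (nrm_dconv_le _ _ _)) _.
have sum_ge0 (c : nat -> A) : 0 <= \sum_(0 <= i < n.+1) nrm (c i).
  by apply: sumr_ge0 => i _; exact: nrm_ge0.
apply: (@le_trans _ _ (U * (e / (U + 1)))).
  by rewrite /U mulrDl; apply: lerD; apply: ler_wpM2l.
by rewrite mulrCA ler_piMr ?(ltW e0)// ler_pdivrMr ?ltr_wpDl// mul1r lerDl.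
Qed.

End Perturbation.

(** * Descent *)

Section Core.
Context {R : realType} {A : completeNormedModType R[i]}.
Context {mul : A -> A -> A} {one : A} (HA : cbanach_alg mul one).
Local Open Scope complex_scope.
Implicit Types (a b u v w : nat -> A) (B C D M x y : R) (s : R[i]) (p q : A).

Local Notation dconv := (dconv mul).
Local Notation dunit := (dunit one).
Local Notation dinvertible := (@dinvertible R A mul one).

Definition delta p : nat -> A := fun n => if n == 1%N then p else 0.

Lemma nl1_delta p : nl1 (delta p) (nrm p).
Proof.
case=> [|[|N]]; first by rewrite big_nil nrm_ge0.
  by rewrite big_nat1 nrm0 nrm_ge0.
rewrite big_nat_recl// big_nat_recl// big1 => [|i _]; last exact: nrm0.
by rewrite nrm0 add0r addr0.
Qed.

Lemma dconv_delta p b n : dconv (delta p) b n = if n == 0%N then 0 else mul p (b n).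
Proof.
case: n => [//|n]; rewrite /Defs.dconv/=.
rewrite (bigD1 (Ordinal (isT : 1 < n.+2)%N))//= divn1 big1 ?addr0// => i.
move=> /andP[_]; rewrite -val_eqE/= /delta => /negbTE ->.
by rewrite (bamul0 HA).
Qed.

Lemma delta_inv p q : mul p q = one -> dconv (delta p) (delta q) = dunit.
Proof.
move=> pq; apply/funext => n; rewrite dconv_delta /delta /Defs.dunit.
by case: n => [|[|n]]//=; rewrite (bamulx0 HA).
Qed.

Lemma dirichlet_delta p s : dirichlet (delta p) s = p.
Proof.
have -> : delta p = trunc 2 (delta p) by apply/funext => -[|[|n]].
rewrite dirichletE ev_trunc !big_nat_recr//= big_nil npow_neg1.
by rewrite scaler0 !add0r scale1r.
Qed.

Lemma perturbation_delta p q b C : mul p q = one -> b 0%N = 0 ->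
  nl1 (fun n => delta p n - b n) C -> C * nrm q < 1 -> dinvertible b.
Proof.
move=> pq b0 bC Cq.
have vM m : nl1 (@dpow R A mul one (delta q) m) (1 * nrm q ^+ m).
  by rewrite mul1r; exact: (nl1_dpow HA m (nl1_delta q)).
have d0 : delta p 0%N - b 0%N = 0 by rewrite b0 subr0.
have -> : b = fun n => delta p n - (delta p n - b n).
  by apply/funext => n; rewrite subKr.
exact: (perturbation HA _ d0 (delta_inv pq) vM bC (nrm_ge0 q) Cq).
Qed.

(** The Neumann series in [A] comes from the one for sequences concentrated at index 1, by reading
    off coefficient 1 of the inverse. *)
Lemma neumann p q r : mul p q = one -> nrm (p - r) * nrm q < 1 ->
  invertible mul one r.
Proof.
move=> pq pr.
have h : nl1 (fun n => delta p n - delta r n) (nrm (p - r)).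
  apply: nl1_dom (nl1_delta (p - r)) => n; rewrite /delta.
  by case: eqP; rewrite ?subrr.
have [w [w0 _ rw]] := perturbation_delta pq (erefl : delta r 0%N = 0) h pr.
by exists (w 1%N); have := congr1 (@^~ 1%N) rw; rewrite dconv_delta.
Qed.

(** In [t = q + q (p - r) t] the last term has norm at most half that of [t], and is absorbed on the
    left. *)
Lemma inverse_bound p q r t M : mul p q = one -> mul r t = one -> nrm q <= M ->
  nrm (p - r) * M <= 1 / 2 -> nrm t <= 2 * M.
Proof.
move=> pq rt qM prM.
have tE : t = q + mul (mul q (p - r)) t.
  rewrite (bamulDr HA) (bamulxN HA) (bamulDl HA) (bamulN HA) -(bamulA HA q r) rt.
  by rewrite (bamulx1 HA) (bamulC HA q p) pq (bamul1 HA) addrC subrK.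
have h1 : nrm t <= nrm q + nrm (mul (mul q (p - r)) t) by rewrite {1}tE ler_nrmD.
have h2 : nrm (mul (mul q (p - r)) t) <= nrm q * nrm (p - r) * nrm t.
  apply: le_trans (ler_nrmM HA _ _) _; rewrite ler_wpM2r ?nrm_ge0//.
  exact: (ler_nrmM HA).
have h3 : nrm q * nrm (p - r) * nrm t <= 1 / 2 * nrm t.
  rewrite ler_wpM2r ?nrm_ge0//; apply: le_trans prM.
  by rewrite mulrC ler_wpM2l// nrm_ge0.
lra.
Qed.

(** All indices from 2 on have weight at most [wt x 2]. Far to the right the series is therefore
    close to its constant term. *)
Lemma nl1_twist_delta a C x : 0 <= x -> a 0%N = 0 -> nl1 a C ->
  nl1 (fun n => delta (a 1%N) n - twist x a n) (wt x 2 * C).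
Proof.
move=> x0 a0 aC N; apply: le_trans (ler_wpM2l (ltW (wt_gt0 x 2)) (aC N)).
rewrite big_distrr/=; apply: ler_sum => -[|[|n]] _.
- by rewrite twist_eq0// subr0 nrm0 mulr_ge0// ?nrm_ge0// ltW// wt_gt0.
- by rewrite /twist wt1 scale1r /delta subrr nrm0 mulr_ge0// ?nrm_ge0// ltW// wt_gt0.
rewrite /delta/= sub0r nrmN nrm_twist ler_wpM2r ?nrm_ge0//.
by rewrite ler_expR ler_wnM2l ?oppr_le0// ler_ln ?natr_pos// ler_nat.
Qed.

Lemma wt2_small (e d : R) : 0 < e -> 0 < d -> exists k : nat, wt (k%:R * d) 2 < e.
Proof.
move=> e0 d0; have l0 : 0 < ln (2 : R) by rewrite ln_gt0// ltr1n.
have c0 : 0 < e * (d * ln 2) by rewrite !mulr_gt0.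
(* With [y = k * d * ln 2 > 1 / e], the inequality [exp y >= 1 + y] gives [2 ^ (- k * d) < e]. *)
exists (Num.bound (e * (d * ln 2))^-1).
set k := Num.bound _.
have : (e * (d * ln 2))^-1 < k%:R by apply: archi_boundP; rewrite invr_ge0 ltW.
rewrite -div1r ltr_pdivrMr// => kb.
rewrite /wt mulNr expRN invf_plt ?posrE ?expR_gt0//.
apply: lt_le_trans (expR_ge1Dx _); rewrite -div1r ltr_pdivrMr//.
move: kb; set l := ln _; lra.
Qed.

(** Factor out [n ^ -x <= n] and use [n ^ -(y - x) >= 1 - (y - x) * ln n] with [ln n <= n]. The
    constant is crude but uniform over a truncated sequence. *)
Lemma wt_lip x y n : (0 < n)%N -> -1 <= x -> x <= y ->
  wt x n - wt y n <= (y - x) * (n%:R * n%:R).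
Proof.
move=> n0 x1 xy; pose l : R := ln n%:R.
have l0 : 0 <= l by exact: lnn_ge0.
have ln_le : l <= n%:R by rewrite ltW// ln_sublinear// ltr0n.
have wn : wt x n <= n%:R.
  apply: le_trans (wt_anti n x1) _.
  by rewrite /wt opprK mul1r lnK// natr_pos.
have wy : wt x n * (1 - (y - x) * l) <= wt y n.
  have -> : wt y n = wt x n * wt (y - x) n by rewrite -wtD addrC subrK.
  rewrite ler_wpM2l ?(ltW (wt_gt0 _ _))//.
  by have := expR_ge1Dx (- (y - x) * l); rewrite {1}mulNr.
have w0 := wt_gt0 x n.
have xy0 : 0 <= y - x by rewrite subr_ge0.
apply: (@le_trans _ _ ((y - x) * (wt x n * l))); first lra.
by rewrite ler_wpM2l// ler_pM// ltW.
Qed.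

Lemma nl1_twist_lip a C N x y : a 0%N = 0 -> nl1 a C -> -1 <= x -> -1 <= y ->
  nl1 (fun n => twist x (trunc N a) n - twist y (trunc N a) n)
    (`|y - x| * (N%:R * N%:R) * C).
Proof.
move=> a0 aC x1 y1 K.
have K0 : 0 <= `|y - x| * (N%:R * N%:R) by rewrite mulr_ge0// mulr_ge0.
apply: le_trans (ler_wpM2l K0 (aC K)); rewrite big_distrr/=.
apply: ler_sum => n _; rewrite /twist /trunc.
case: ifPn => nN; last by rewrite !scaler0 subrr nrm0 mulr_ge0// nrm_ge0.
case: n nN => [|n] nN; first by rewrite a0 !scaler0 subrr nrm0 mulr_ge0.
rewrite -scalerBl -rmorphB nrmZ nrm_real ler_wpM2r ?nrm_ge0//.
have nn : n.+1%:R * n.+1%:R <= N%:R * N%:R :> R.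
  by rewrite ler_pM// ler_nat ltnW.
case: (leP x y) => [xy|/ltW xy].
  rewrite ger0_norm ?subr_ge0 ?wt_anti//.
  apply: le_trans (wt_lip (ltn0Sn n) x1 xy) _.
  by rewrite ger0_norm ?subr_ge0// ler_wpM2l// subr_ge0.
rewrite distrC ger0_norm ?subr_ge0 ?wt_anti// (distrC y).
apply: le_trans (wt_lip (ltn0Sn n) y1 xy) _.
by rewrite ger0_norm ?subr_ge0// ler_wpM2l// subr_ge0.
Qed.

Lemma trunc_support N a n : ~~ [pred p | p <= N]%N.-nat n -> a 0%N = 0 ->
  trunc N a n = 0.
Proof.
move=> nN a0; rewrite /trunc; case: ifPn => // nltN.
case: n nN nltN => [//|n] + nltN; move/negP; case; apply/pnatP => // p _ pn.
by rewrite inE/= (leq_trans (dvdn_leq _ pn))// ltnW.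
Qed.

Lemma core_invertible a C M p : a 0%N = 0 -> nl1 a C -> 0 < M ->
  (forall s, Hplane s -> exists2 y, mul (dirichlet a s) y = one & nrm y <= M) ->
  mul (a 1%N) p = one -> dinvertible a.
Proof.
move=> a0 aC M0 aM a1p.
have C0 := nl1_ge0 aC.
(* Truncation costs [e * M = 1 / 4] of the margin 1 / 2 in [inverse_bound], and [e * (2 * M) < 1]
   serves the last perturbation. *)
pose e : R := (4 * M)^-1.
have e0 : 0 < e by rewrite invr_gt0 mulr_gt0.
have eM : e * M = 4^-1 by rewrite /e invfM -mulrA mulVf ?mulr1// gt_eqF.
have [N0 aN0] := nl1_trunc_small aC e0.
(* Having [1 < N] guarantees that truncation keeps the coefficient [a 1]. *)
pose N := (N0 + 2)%N; have N1 : (1 < N)%N by rewrite /N addn2.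
have aN := aN0 N (leq_addr _ _).
pose P := trunc N a.
have P0 : P 0%N = 0 by rewrite /P /trunc a0; case: ifP.
have PC : nl1 P C by exact: nl1_trunc.
pose L : R := N%:R * N%:R * C.
have L0 : 0 <= L by rewrite mulr_ge0// mulr_ge0.
(* Chosen so that [d <= 1], which keeps abscissas from [- d] on in the range of [wt_lip], and
   [d * L * M <= 1 / 8]: moving by [d] fits in the margin of [inverse_bound], and moving by [2 * d]
   is a perturbation below [1 / (2 * M)]. *)
pose d : R := (8 * M * L + 1)^-1.
have ML0 : 0 <= M * L by rewrite mulr_ge0// ltW.
have den0 : 0 < 8 * M * L + 1 by lra.
have d0 : 0 < d by rewrite invr_gt0.
have dE : d * (8 * M * L + 1) = 1 by rewrite mulVf// gt_eqF.
have d1 : d <= 1 by have : 0 <= d * (M * L) by [rewrite mulr_ge0// ltW]; lra.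
have dLM : d * L * M <= 8^-1 by lra.
have lip x y : -1 <= x -> -1 <= y ->
    nl1 (fun n => twist x P n - twist y P n) (`|y - x| * L).
  by move=> x1 y1; rewrite /L mulrA; exact: nl1_twist_lip.
(* Left of the imaginary axis [P] cannot be compared with [a] at the same point, so the comparison
   is with [a] on the line [Re s = z], where [z] is the larger of [x] and 0. The distance is at most
   [e + d * L]. *)
have bound x v D : - d <= x -> nl1 v D -> dconv (twist x P) v = dunit ->
    forall t : R, nrm (dirichlet v (0 +i* t)) <= 2 * M.
  move=> xd vD xv t; pose z := Num.max x 0.
  have z0 : 0 <= z by rewrite le_max lexx orbT.
  have tH : @Hplane R (0 +i* t) by rewrite /Hplane/=.
  have ztH : Hplane (z%:C + (0 +i* t)) by rewrite /Hplane/= addr0.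
  have [y zy yM] := aM _ ztH; rewrite dirichlet_shift in zy.
  have t1 := npow_neg_le1 tH.
  have xP : exists D', nl1 (twist x P) D'.
    have x1 : -1 <= x by lra.
    have := nl1D (lip x 0 x1 _) (nl1_twist (lexx 0) PC).
    under eq_fun do rewrite subrK.
    by move=> h; eexists; apply: h; lra.
  have [D' xPD] := xP.
  have pq : mul (dirichlet (twist x P) (0 +i* t)) (dirichlet v (0 +i* t)) = one.
    rewrite !dirichletE -(ev_dconv HA t1 (npow_neg0 _) (fun i j => npow_negM i j _) xPD vD).
    by rewrite xv ev_dunit// npow_neg1.
  apply: (inverse_bound zy pq yM).
  have zaC := nl1_twist z0 aC.
  rewrite !dirichletE -(evB t1 zaC xPD).
  have diff : nl1 (fun n => twist z a n - twist x P n) (e + d * L).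
    have := nl1D (nl1_twist z0 aN) (lip z x _ _).
    have -> : (fun n => twist z (fun n => a n - trunc N a n) n +
      (twist z P n - twist x P n)) = (fun n => twist z a n - twist x P n).
      by apply/funext => n; rewrite twistB addrA subrK.
    move=> /(_ _ _)/nl1_le; apply; try lra.
    rewrite lerD2l ler_wpM2r// /z; case: (leP x 0) => [x0|_]; last by rewrite subrr normr0 ltW.
    by rewrite subr0 ler0_norm//; lra.
  apply: le_trans (ler_wpM2r (ltW M0) (ev_le t1 diff)) _.
  by rewrite mulrDl eM; lra.
(* An inverse on the line [x], restricted to smooth integers and twisted by [d], has powers of l1
   norm at most [B * (2 * M) ^ m]. Hence everything closer than [1 / (2 * M)] to [P] on the line
   [x + d] is invertible. *)
have step x b D : - d <= x -> dinvertible (twist x P) -> b 0%N = 0 ->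
    nl1 (fun n => twist (x + d) P n - b n) D -> D * (2 * M) < 1 -> dinvertible b.
  move=> xd [v [v0 [Cv vC] xv]] b0 bD DM.
  pose pi : nat_pred := [pred q | q <= N.-1.+1]%N.
  have Ppi n : ~~ pi.-nat n -> twist x P n = 0.
    move=> npi; rewrite twist_eq0// /P trunc_support//.
    by move: npi; rewrite /pi prednK// (ltn_trans _ N1).
  have rC : nl1 (restr pi v) Cv.
    by apply: nl1_dom vC => n; rewrite /restr; case: ifP; rewrite // nrm0 nrm_ge0.
  have xr := dconv_restr HA Ppi xv.
  have rpi n : ~~ pi.-nat n -> restr pi v n = 0 by rewrite /restr => /negbTE ->.
  have r0 : restr pi v 0%N = 0 by [].
  have [B B0 rB] := nl1_dpow_twist HA d0 rC rpi (bound x _ _ xd rC xr).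
  have dr : dconv (twist (x + d) P) (twist d (restr pi v)) = dunit.
    by rewrite addrC -twistD -(twist_dconv HA) xr twist_dunit.
  have -> : b = fun n => twist (x + d) P n - (twist (x + d) P n - b n).
    by apply/funext => n; rewrite subKr.
  apply: (perturbation HA _ _ dr rB bD) => //.
  - exact: twist_eq0.
  - by rewrite b0 subr0 twist_eq0.
  - by rewrite mulr_ge0// ltW.
(* The abscissas start at [x 0 = - d]. A step first gains [d] to the right, so reaching [x j] from
   [x j.+1] costs a shift by [2 * d]. *)
pose x (j : nat) : R := (j%:R - 1) * d.
have x_ge j : - d <= x j by rewrite /x mulrBl mul1r lerDr mulr_ge0// ltW.
have descent j : dinvertible (twist (x j.+1) P) -> dinvertible (twist (x j) P).
  have xE : x j - (x j.+1 + d) = - (2 * d).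
    by rewrite /x -natr1; ring.
  have j1 := x_ge j; have j2 := x_ge j.+1.
  move=> /(step _ (twist (x j) P) (2 * d * L) (x_ge _)); apply.
  - exact: twist_eq0.
  - have := lip (x j.+1 + d) (x j); rewrite xE normrN ger0_norm.
      by apply; lra.
    by rewrite mulr_ge0// ltW.
  - lra.
(* The threshold makes the distance from the twist of [P] to the constant [a 1], times [nrm p],
   smaller than 1. *)
have [k kd] : exists k : nat, wt (k%:R * d) 2 < (C * nrm p + 1)^-1.
  by apply: wt2_small => //; rewrite invr_gt0 ltr_wpDl// mulr_ge0// nrm_ge0.
have start : dinvertible (twist (x k.+1) P).
  have xE : x k.+1 = k%:R * d by rewrite /x -natr1; ring.
  have kd0 : 0 <= k%:R * d by rewrite mulr_ge0// ltW.
  have := nl1_twist_delta kd0 P0 PC.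
  have -> : P 1%N = a 1%N by rewrite /P /trunc N1.
  rewrite xE => /(perturbation_delta a1p); apply; first exact: twist_eq0.
  have Cp0 : 0 <= C * nrm p by rewrite mulr_ge0// nrm_ge0.
  have := wt_gt0 (k%:R * d) 2; move: kd; rewrite -div1r ltr_pdivlMr; last by lra.
  by move: (wt _ _) Cp0 => W; rewrite -mulrA; move: (C * nrm p) => c; nra.
have all0 : dinvertible (twist (x 0%N) P).
  by elim: (k.+1) start => [//|j IH] /descent.
(* From the line [- d] the gain of [d] lands exactly on the imaginary axis, where [a] is within [e]
   of [P]. *)
apply: (step (x 0%N) a e (x_ge 0%N) all0 a0); last by lra.
have -> : x 0%N + d = 0 by rewrite /x; ring.
by rewrite twist0; apply: nl1_dom aN => n; rewrite nrmB.
Qed.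

End Core.

(** * Compactness and uniform bounds *)

Section UniformBound.
Context {R : realType} {A : completeNormedModType R[i]}.
Context {mul : A -> A -> A} {one : A} (HA : cbanach_alg mul one).
Local Open Scope complex_scope.
Implicit Types (a b : nat -> A) (C D M : R) (s : R[i]).

(** In the compact segment the image ultrafilter has a cluster point, and an ultrafilter converges
    to its cluster points. Ultrafilters replace a diagonal extraction: a single one serves all
    indices [n] at once. *)
Lemma ultra_cvg_real (T : Type) (U : set_system T) (UU : UltraFilter U)
    (u : T -> R) : (forall k, `|u k| <= 1) ->
  exists p, forall e : R, 0 < e -> \forall k \near U, `|p - u k| < e.
Proof.
move=> u1.
have uF : (u @ U) `[(-1 : R), 1]%classic.
  by apply: nearW => k /=; rewrite in_itv/= -ler_norml.
have [p [_ pc]] := segment_compact (fmap_proper_filter u _) uF.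
exists p => e e0; have [//|h] := in_ultra_setVsetC [set k | `|p - u k| < e] UU.
have [] := pc (~` ball p e) (ball p e) _ (nbhsx_ballx p e e0); last by move=> x [].
by rewrite -ball_normE; exact: h.
Qed.

Lemma nrm_le_ReIm (z : R[i]) : nrm z <= `|complex.Re z| + `|complex.Im z|.
Proof.
have -> : nrm z = nrm ((complex.Re z)%:C + 'i%C * (complex.Im z)%:C).
  by rewrite -complexE.
apply: le_trans (ler_nrmD _ _) _.
by rewrite nrmcM !nrm_real /nrm normc_def /= expr0n expr1n add0r sqrtr1 mul1r.
Qed.

Lemma Re_le_nrm (z : R[i]) : `|complex.Re z| <= nrm z.
Proof. by rewrite -lecR -nrmE normc_ge_Re. Qed.

Lemma Im_le_nrm (z : R[i]) : `|complex.Im z| <= nrm z.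
Proof.
have := Re_le_nrm (z * 'i%C); rewrite ReiNIm normrN nrmcM.
by rewrite [nrm 'i%C]/nrm normc_def /= expr0n expr1n add0r sqrtr1 mulr1.
Qed.

Lemma ultra_cvg_complex (T : Type) (U : set_system T) (UU : UltraFilter U)
    (z : T -> R[i]) : (forall k, nrm (z k) <= 1) ->
  exists p, forall e : R, 0 < e -> \forall k \near U, nrm (p - z k) < e.
Proof.
move=> z1.
have [x zx] := ultra_cvg_real UU (fun k => le_trans (Re_le_nrm (z k)) (z1 k)).
have [y zy] := ultra_cvg_real UU (fun k => le_trans (Im_le_nrm (z k)) (z1 k)).
exists (x +i* y) => e e0; have e2 : 0 < e / 2 by rewrite divr_gt0.
apply: filterS2 (zx _ e2) (zy _ e2) => k.
have := nrm_le_ReIm ((x +i* y) - z k); case: (z k) => zr zi /=; lra.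
Qed.

(* Along an ultrafilter every bounded sequence [npow_neg n (s k)] converges, so
   the values [dirichlet a (s k)] do too. *)
Lemma ultra_cvg_dirichlet (T : Type) (U : set_system T) (UU : UltraFilter U)
    (s : T -> R[i]) a C : nl1 a C -> (forall k, Hplane (s k)) ->
  exists l : A, forall e : R, 0 < e ->
    \forall k \near U, nrm (l - dirichlet a (s k)) < e.
Proof.
move=> aC sH.
suff FC : cvg (dirichlet a (s k) @[k --> U]).
  by exists (lim (dirichlet a (s k) @[k --> U])); apply/cvg_nrm.
apply: cauchy_nrm => e e0; have e2 : 0 < e / 2 by rewrite divr_gt0.
have [N /(_ N (leqnn N)) aN] := nl1_trunc_small aC e2.
have finU (K : nat) : exists l : A, forall d : R, 0 < d -> \forall k \near U,
    nrm (l - \sum_(0 <= n < K) npow_neg n (s k) *: a n) < d.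
  elim: K => [|K [l lM]].
    by exists 0 => d d0; apply: nearW => k; rewrite big_nil subrr nrm0.
  have [p zp] := ultra_cvg_complex UU (fun k => npow_neg_le1 (sH k) K).
  exists (l + p *: a K) => d d0; have d2 : 0 < d / 2 by rewrite divr_gt0.
  have c0 : 0 < nrm (a K) + 1 by rewrite ltr_wpDl// nrm_ge0.
  have d3 : 0 < d / 2 / (nrm (a K) + 1) by rewrite divr_gt0.
  apply: filterS2 (lM _ d2) (zp _ d3) => k h1 h2.
  rewrite big_nat_recr//= opprD addrACA -scalerBl.
  apply: le_lt_trans (ler_nrmD _ _) _; rewrite (splitr d); apply: ltr_leD => //.
  rewrite nrmZ; move: h2; rewrite ltr_pdivlMr// => /ltW; apply: le_trans.
  by rewrite ler_wpM2l ?nrm_ge0// lerDl.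
have [l lN] := finU N; exists l.
change (\forall k \near U, nrm (l - dirichlet a (s k)) < e).
apply: filterS (lN _ e2) => k h.
have k1 := npow_neg_le1 (sH k).
have -> : l - dirichlet a (s k) =
    (l - dirichlet (trunc N a) (s k)) - dirichlet (fun n => a n - trunc N a n) (s k).
  rewrite !dirichletE (evB k1 aC (nl1_trunc N aC)).
  by rewrite opprB addrA subrK.
apply: le_lt_trans (ler_nrmB _ _) _; rewrite (splitr e); apply: ltr_leD.
  by rewrite dirichletE ev_trunc.
by rewrite dirichletE; exact: (ev_le k1 aN).
Qed.

Lemma closure_nrmP (E : set A) (x : A) :
  closure E x <-> forall e : R, 0 < e -> exists2 y, E y & nrm (x - y) < e.
Proof.
split=> [Ex e e0|Ex B].
  have [|y [Ey xy]] := Ex (fun y => nrm (x - y) < e).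
    apply/nbhs_ballP; exists e%:C => /=; first by rewrite ltcR.
    by move=> y; rewrite -ball_normE/= nrmE ltcR.
  by exists y.
move=> /nbhs_ballP[e /= e0 eB].
have eE : (complex.Re e)%:C = e by rewrite RRe_real// gtr0_real.
have [|y Ey xy] := Ex (complex.Re e); first by rewrite -ltcR eE.
exists y; split => //; apply: eB; rewrite -ball_normE/=.
by rewrite nrmE -eE ltcR.
Qed.

(** Otherwise some [s k] have inverses of norm above [k]. Along an ultrafilter finer than [\oo] the
    values converge to a point [l] of the closure, and [inverse_bound] near the invertible [l]
    bounds those inverses. This is where the closure matters, since [l] need not be a value. *)
Lemma uniform_inverse_bound a C : nl1 a C ->
  closure (dirichlet a @` @Hplane R) `<=` invertible mul one ->
  exists2 M, 0 < M & forall s, Hplane s ->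
    exists2 y, mul (dirichlet a s) y = one & nrm y <= M.
Proof.
move=> aC ainv; apply: contrapT => noM.
(* Quantifying over all inverses avoids choosing one; uniqueness of inverses then supplies the
   contradiction. *)
have bad (k : nat) : exists s, Hplane s /\
    forall y, mul (dirichlet a s) y = one -> k%:R < nrm y.
  apply: contrapT => nos; apply: noM; exists (k%:R + 1); first by rewrite ltr_wpDl.
  move=> s sH; have [y sy] : invertible mul one (dirichlet a s).
    by apply: ainv; apply: subset_closure; exists s.
  exists y => //; rewrite leNgt; apply/negP => ky; apply: nos; exists s; split=> // t st.
  have -> : t = y.
    by rewrite -(bamul1 HA t) -sy (bamulC HA _ y) -(bamulA HA) st (bamulx1 HA).
  by rewrite (le_lt_trans _ ky)// lerDl.
have [s sP] := choice bad.
have sH k : Hplane (s k) by have [] := sP k.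
have [U [UU oU]] := ultraFilterLemma (eventually_filter : ProperFilter \oo).
have [l lU] := ultra_cvg_dirichlet UU aC sH.
have [y ly] : invertible mul one l.
  apply: ainv; apply/closure_nrmP => e e0.
  have /filter_ex[k lk] := lU e e0.
  by exists (dirichlet a (s k)) => //; exists (s k).
pose M := nrm y + 1; have M0 : 0 < M by rewrite ltr_wpDl// nrm_ge0.
have e0 : 0 < 1 / 2 / M by rewrite divr_gt0.
have oo : U [set k | 2 * M < k%:R].
  apply: oU; exists (Num.bound (2 * M)) => // k /= Mk.
  apply: lt_le_trans (archi_boundP _) _; first by rewrite mulr_ge0// ltW.
  by rewrite ler_nat.
have lU0 : U [set k | nrm (l - dirichlet a (s k)) < 1 / 2 / M] := lU _ e0.
have [k [/= lk Mk]] := filter_ex (filterI lU0 oo).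
have [t st] : invertible mul one (dirichlet a (s k)).
  by apply: ainv; apply: subset_closure; exists (s k).
have [_ /(_ t st)] := sP k; rewrite ltNge => /negP; apply.
apply: le_trans (ltW Mk); apply: (inverse_bound HA ly st).
  by rewrite lerDl.
by move: lk; rewrite ltr_pdivlMr// => /ltW.
Qed.

(** The inverses of the values have norm at most [C], so a point of the closure is close enough to
    some value for [neumann]. *)
Lemma invertible_closure a b C : nl1 b C ->
  (forall s, @Hplane R s -> mul (dirichlet a s) (dirichlet b s) = one) ->
  closure (dirichlet a @` @Hplane R) `<=` invertible mul one.
Proof.
move=> bC ab x /closure_nrmP xa.
have C0 := nl1_ge0 bC.
have e0 : 0 < (C + 1)^-1 by rewrite invr_gt0 ltr_wpDl.
have [_ [s sH <-] xs] := xa _ e0.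
apply: (neumann HA (ab s sH)); rewrite nrmB.
have bs : nrm (dirichlet b s) <= C by rewrite dirichletE; exact: (ev_le (npow_neg_le1 sH) bC).
apply: le_lt_trans (ler_wpM2l (nrm_ge0 _) bs) _.
move: xs; rewrite -div1r ltr_pdivlMr ?ltr_wpDl// => h.
by apply: le_lt_trans h; rewrite ler_wpM2l ?nrm_ge0// lerDl.
Qed.

(** The coefficient [a 1] is the limit of [f_a (k)] as [k] grows. Its invertibility, needed to start
    the descent, thus follows from (ii). *)
Lemma coef1_in_closure a C : a 0%N = 0 -> nl1 a C ->
  closure (dirichlet a @` @Hplane R) (a 1%N).
Proof.
move=> a0 aC; apply/closure_nrmP => e e0.
have C0 := nl1_ge0 aC.
have C1 : 0 < C + 1 by rewrite ltr_wpDl.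
have [k kP] : exists k : nat, wt (k%:R * 1) 2 < e / (C + 1).
  by apply: wt2_small; rewrite ?divr_gt0.
have k0 : 0 <= k%:R * 1 :> R by rewrite mulr1.
have sH : Hplane ((k%:R * 1)%:C + 0 : R[i]) by rewrite /Hplane/= addr0.
have H0 : @Hplane R 0 by rewrite /Hplane/=.
exists (dirichlet a ((k%:R * 1)%:C + 0)); first by exists ((k%:R * 1)%:C + 0).
rewrite dirichlet_shift -{1}(dirichlet_delta (a 1%N) 0) !dirichletE.
rewrite -(evB (npow_neg_le1 H0) (nl1_delta _) (nl1_twist k0 aC)).
apply: le_lt_trans (ev_le (npow_neg_le1 H0) (nl1_twist_delta k0 a0 aC)) _.
move: kP; rewrite ltr_pdivlMr// => h; apply: le_lt_trans h.
by rewrite ler_wpM2l ?(ltW (wt_gt0 _ _))// lerDl.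
Qed.

End UniformBound.

(** * The cycle of implications and its transfer to functions *)

Theorem theorem1 (R : realType) (A : completeNormedModType R[i])
  (mul : A -> A -> A) (one : A) (HA : cbanach_alg mul one)
  (a : nat -> A) (ha : l1 a) :
  (l1_invertible mul one a <->
     closure (dirichlet a @` @Hplane R) `<=` invertible mul one) /\
  (closure (dirichlet a @` @Hplane R) `<=` invertible mul one <->
     exists b, l1 b /\
       forall s, @Hplane R s -> mul (dirichlet a s) (dirichlet b s) = one) /\
  (forall f : R[i] -> A, inD f ->
     (D_invertible mul one f <->
        closure (f @` @Hplane R) `<=` invertible mul one)).
Proof.
(* The cycle is (i) to (iii) to (ii) to (i), for an arbitrary sequence [c], since the last claim
   applies it to the coefficients of [f]. *)
have i_iii (c : nat -> A) : l1 c -> l1_invertible mul one c -> exists b, l1 b /\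
    forall s, @Hplane R s -> mul (dirichlet c s) (dirichlet b s) = one.
  move=> /l1P[_ [C cC]] [b [/[dup] lb /l1P[_ [D bD]] [cb _]]].
  exists b; split=> // s sH.
  rewrite !dirichletE -(ev_dconv HA (npow_neg_le1 sH) (npow_neg0 s) _ cC bD).
    by rewrite cb ev_dunit// npow_neg1.
  by move=> m n; exact: npow_negM.
have iii_ii (c : nat -> A) : (exists b, l1 b /\
    forall s, @Hplane R s -> mul (dirichlet c s) (dirichlet b s) = one) ->
    closure (dirichlet c @` @Hplane R) `<=` invertible mul one.
  by move=> [b [/l1P[_ [D bD]] cb]]; exact: (invertible_closure HA bD cb).
have ii_i (c : nat -> A) : l1 c ->
    closure (dirichlet c @` @Hplane R) `<=` invertible mul one ->
    l1_invertible mul one c.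
  move=> /l1P[c0 [C cC]] cinv.
  have [M M0 cM] := uniform_inverse_bound HA cC cinv.
  have [p c1p] := cinv _ (coef1_in_closure c0 cC).
  have [v [v0 vl cv]] := core_invertible HA c0 cC M0 cM c1p.
  by exists v; split; [exact/l1P|split=> //; rewrite (dconvC HA)].
split; first by split=> [/(i_iii a ha)/iii_ii|/(ii_i a ha)].
split; first by split=> [/(ii_i a ha)/(i_iii a ha)|/iii_ii].
move=> f [c [lc fc]].
(* Values of [f] off the half-plane are arbitrary, so only the images of the half-plane are
   identified. *)
have -> : f @` @Hplane R = dirichlet c @` @Hplane R.
  by apply/seteqP; split=> _ [s sH <-]; exists s => //; rewrite fc.
split=> [[g [[b [lb gb]] fg]]|/(ii_i c lc)/(i_iii c lc)[b [lb cb]]].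
  by apply: iii_ii; exists b; split=> // s sH; rewrite -fc// -gb// fg.
exists (dirichlet b); split; first by exists b.
by move=> s sH; rewrite fc// cb.
Qed.
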